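(* Suppose $\max_{1\le i\le m}p_i=o((\ln n)^{-1})$ and $S_1=n(\ln n+c_n)$, where $(c_n)$ has a limit in $[-\infty,\infty]$. Then $$\lim_{n\to\infty}\Pr\{\mathcal G(2n,m(2n),\overline p(2n))\text{ has a perfect matching}\}=f(c_{2n}).$$
   Context: All limits are as $n\to\infty$. For each $n$, $m=m(n)$ is a positive integer and $\overline p=\overline p(n)=(p_1,\dots,p_m)$ with $p_i\in(0,1)$. For $N$ vertices, the random intersection graph $\mathcal G(N,m,\overline p)$ has vertex set $\{v_1,\dots,v_N\}$; each vertex $v$ adds feature $w_i$ ($1\le i\le m$) to its feature set $W(v)$ independently with probability $p_i$ (independently over all vertices and features), and distinct $v,v'$ are adjacent iff $W(v)\cap W(v')\ne\emptyset$. Here $S_1=S_1(n)=\sum_{i=1}^{m(n)} np_i(1-(1-p_i)^{n-1})$ with $p_i$ the entries of $\overline p(n)$. For a sequence $c_n$ with a limit in $[-\infty,\infty]$, $f(c_n)=0$ if $c_n\to-\infty$, $f(c_n)=e^{-e^{-c}}$ if $c_n\to c\in\mathbb R$, and $f(c_n)=1$ if $c_n\to\infty$. *)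

(* Defs.v *)
From HB Require Import structures.
From mathcomp Require Import all_boot all_order all_algebra.
From mathcomp Require Import all_classical all_reals all_analysis.
Import Order.TTheory GRing.Theory Num.Theory.
Import numFieldNormedType.Exports.

Set Implicit Arguments.
Unset Strict Implicit.
Unset Printing Implicit Defensive.

Local Open Scope classical_set_scope.
Local Open Scope ring_scope.

Section Graphs.
Variables (V : finType) (adj : rel V).

(* Meant for a symmetric irreflexive [adj]; an edge is then an unordered pair
   of distinct vertices. *)
Definition edges : {set {set V}} :=
  [set [set z.1; z.2] | z in [pred z : V * V | adj z.1 z.2]]%SET.

Definition perfect_matching (M : {set {set V}}) : bool :=
  [&& M \subset edges, finset.trivIset M & finset.cover M == [set: V]%SET].

Definition has_perfect_matching : bool :=
  [exists M : {set {set V}}, perfect_matching M].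

End Graphs.

Section RandomIntersectionGraph.
Variables (R : realType) (N m : nat).

(* An outcome is the family of feature sets [v |-> W v]. *)
Definition features : finType := {ffun 'I_N -> {set 'I_m}}.

Definition rig_adj (W : features) : rel 'I_N :=
  fun v v' => (v != v') && (W v :&: W v' != finset.set0)%SET.

Variable p : 'I_m -> R.

(* Probability mass of an outcome: all the events [i \in W v] are independent,
   the one for (v, i) having probability [p i]. *)
Definition rig_mass (W : features) : R :=
  \prod_(v < N) \prod_(i < m) (if i \in W v then p i else 1 - p i).

Definition rig_Pr (E : pred features) : R := \sum_(W | E W) rig_mass W.

End RandomIntersectionGraph.

Definition S1 (R : realType) (m : nat) (p : 'I_m -> R) (n : nat) : R :=
  \sum_(i < m) n%:R * p i * (1 - (1 - p i) ^+ n.-1).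

(* Depends only on the limit of [c] in [-oo, +oo], assumed to exist. *)
Definition flim (R : realType) (c : nat -> R) : R :=
  match lim ((c n)%:E @[n --> \oo]) with
  | r%:E => expR (- expR (- r))
  | +oo%E => 1
  | -oo%E => 0
  end.

(* Main.v *)
Require Import Defs.
From HB Require Import structures.
From mathcomp Require Import all_boot all_order all_algebra.
From mathcomp Require Import all_classical all_reals all_analysis.
From mathcomp Require Import ring lra zify.
Import Order.TTheory GRing.Theory Num.Theory.
Import numFieldNormedType.Exports.

(* Let N be the (even) number of vertices, V_i the random vertex set of feature i
   and q_i = p_i (1 - (1 - p_i)^(N-1)), so that sum_i q_i = ln N + c_N. A perfect
   matching excludes isolated vertices, and for bounded c_N Bonferroni's
   inequalities applied to the factorial moments, which are products over the
   features, show that Pr (no isolated vertex) -> exp (- exp (- c)); for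
   c_N -> - oo Chebyshev's inequality gives 0.

   For the lower bound, a feature of large p_i is split into k independent
   features of density r with (1 - r)^k = 1 - p_i; merging them recovers V_i and
   only adds edges. One may thus assume p_i <= B / N with B = sqrt (ln N), the
   loss in sum_i q_i being o(1), and after deleting features also that
   sum_i q_i = ln N + a + o(1) for any given a < lim c_N. Then, except with
   probability o(1), the absence of isolated vertices implies a perfect matching.
   Indeed, by the Gallai-Edmonds type argument below it suffices that |N(U)| >= |U|
   for every small U and that any two disjoint sets of N / 7 vertices are joined
   by an edge. The second property is a plain union bound. A minimal U violating
   the first one is such that T = U u N(U) is connected, hence
   sum_i (|V_i n T| - 1)^+ >= |T| - 1, while no feature joins U to the complement
   of T; an exponential moment bound for this sum makes the union bound over all
   pairs (U, T) with |T| < 2 |U| converge. *)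

Set Implicit Arguments.
Unset Strict Implicit.
Unset Printing Implicit Defensive.

(** * Maximum matchings in expanders *)

Section Matching.
Import mathcomp.boot.fintype mathcomp.boot.finset.
Local Open Scope set_scope.
Variables (V : finType) (adj : rel V).
Hypothesis adj_sym : symmetric adj.
Hypothesis adj_irr : irreflexive adj.
Implicit Types (f g M N : {ffun V -> V}) (F U : {set V}).


(** Splitting is forced by the exponential moment. For t = |T|, the weight z that cancels the number
    of sets T is N / t up to a power of B, and the moment of a single feature is under control only
    if z t p_i <= 1, so N p_i must be at most a power of B. The size of B is a compromise. Splitting
    loses a fraction exp (- B / 8) of Q = sum_i q_i, which asks B to outgrow ln ln N. Two sets of
    linear size are joined by an expected number of features that is only bounded below by order N Q
    / B, and this must beat the logarithm of the 4^N pairs, which asks for B = o(ln N). Deleting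
    features down to ln N + a makes Q - ln N converge, so that the limit of Pr (no isolated vertex)
    applies to the modified family too; continuity of exp (- exp (- a)) then lets a approach lim
    c_N. The bound on max p_i serves to make sum_i p_i^2 small: this sum is the error in replacing
    the probability that k given vertices are isolated by exp (- k Q). *)

Definition is_matching (f : {ffun V -> V}) :=
  [forall x, (f (f x) == x) && ((f x == x) || adj x (f x))].

Definition unmatched (f : {ffun V -> V}) := finset (fun x => f x == x).

Definition is_maximum (f : {ffun V -> V}) :=
  is_matching f &&
  [forall g : {ffun V -> V}, is_matching g ==> (#|unmatched f| <= #|unmatched g|)].

Lemma is_matchingP f :
  reflect ((forall x, f (f x) = x) /\ (forall x, f x = x \/ adj x (f x)))
          (is_matching f).
Proof.
apply: (iffP forallP) => [h|[h1 h2] x].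
  split=> x; have /andP[/eqP h1 h2] := h x => //.
  by case/orP: h2 => [/eqP|]; [left|right].
by rewrite h1 eqxx /=; case: (h2 x) => [->|->]; rewrite ?eqxx ?orbT.
Qed.

Lemma is_maximum_matching f : is_maximum f -> is_matching f.
Proof. by case/andP. Qed.

Lemma matchingK f : is_matching f -> involutive f.
Proof. by case/is_matchingP. Qed.

Lemma matching_adj f x : is_matching f -> f x != x -> adj x (f x).
Proof. by case/is_matchingP => _ /(_ x)[->|//]; rewrite eqxx. Qed.

Lemma exists_maximum : exists f, is_maximum f.
Proof.
pose f0 : {ffun V -> V} := [ffun x => x].
have h0 : is_matching f0.
  by apply/is_matchingP; split=> x; rewrite !ffunE //; left.
exists [arg min_(f < f0 | is_matching f) #|unmatched f|].
case: arg_minnP => // f hf hmin; rewrite /is_maximum hf /=.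
by apply/forallP => g; apply/implyP => /hmin.
Qed.

Lemma maximum_card f g : is_maximum f -> is_matching g ->
  #|unmatched f| <= #|unmatched g|.
Proof. by case/andP => _ /forallP/(_ g)/implyP. Qed.

(** Replaces the edge [{x, f x}] by [{y, x}], where [y] is meant to be unmatched: the unmatched
    vertex moves from [y] to [f x]. Iterating this move walks along an alternating path. *)
Definition rotate (f : {ffun V -> V}) (y x : V) : {ffun V -> V} :=
  [ffun t => if t == y then x else if t == x then y
             else if t == f x then t else f t].

Lemma rotate_matching f y x :
  is_matching f -> f y = y -> adj y x -> is_matching (rotate f y x).
Proof.
move=> hf fy axy; have [fK fa] := is_matchingP _ hf.
have nxy : x != y by apply/eqP => e; rewrite e adj_irr in axy.
apply/is_matchingP; split=> t; rewrite !ffunE.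
  case: (eqVneq t y) => [->|nty]; first by rewrite (negbTE nxy) eqxx.
  case: (eqVneq t x) => [->|ntx]; first by rewrite eqxx.
  case: (eqVneq t (f x)) => [e|ntfx].
    by rewrite (negbTE nty) (negbTE ntx) e eqxx.
  have -> : (f t == y) = false.
    by apply/eqP => e; case/eqP: nty; rewrite -(fK t) e fy.
  have -> : (f t == x) = false by apply/eqP => e; case/eqP: ntfx; rewrite -e fK.
  by rewrite (can_eq fK) (negbTE ntx) fK.
case: (eqVneq t y) => [->|nty]; first by right.
case: (eqVneq t x) => [->|ntx]; first by right; rewrite adj_sym.
by case: (eqVneq t (f x)) => [e|ntfx]; [left|apply: fa].
Qed.

Lemma rotate_unmatched f y x : adj y x ->
  unmatched (rotate f y x) \subset f x |: (unmatched f :\ y).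
Proof.
move=> axy; have nxy : x != y by apply/eqP => e; rewrite e adj_irr in axy.
apply/subsetP => t; rewrite !inE !ffunE.
case: (eqVneq t y) => [->|nty]; first by rewrite (negbTE nxy).
case: (eqVneq t x) => [->|ntx]; first by rewrite eq_sym (negbTE nxy).
by case: (eqVneq t (f x)).
Qed.

(** Were [x] unmatched, the rotation would leave fewer unmatched vertices than [f] does. *)
Lemma rotate_maximum f y x : is_maximum f -> f y = y -> adj y x ->
  f x != x /\ is_maximum (rotate f y x).
Proof.
move=> hf fy axy; have hm := is_maximum_matching hf.
have hr := rotate_matching hm fy axy.
have hc := subset_leq_card (rotate_unmatched f axy).
have yf : y \in unmatched f by rewrite inE fy.
have hle := maximum_card hf hr.
have c1 := cardsD1 y (unmatched f); rewrite yf in c1.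
have nx : f x != x.
  apply/eqP => fx.
  have xin : f x \in unmatched f :\ y.
    rewrite !inE fx fx eqxx andbT; apply/eqP => e.
    by move: axy; rewrite e adj_irr.
  move: hc; rewrite cardsU1 xin /= => hc; lia.
split=> //; apply/andP; split=> //; apply/forallP => g; apply/implyP => hg.
apply: leq_trans (maximum_card hf hg).
apply: (leq_trans hc); rewrite cardsU1; case: (_ \notin _) => /=; lia.
Qed.

Definition fixes (F : {set V}) (f : {ffun V -> V}) := F \subset unmatched f.

(* [M''] is obtained from [M'] by following the alternating path from [y] and
   switching it as long as possible. *)
Lemma exchange (F : {set V}) M M' y :
  is_maximum M -> is_maximum M' -> fixes F M -> fixes F M' -> M' y = y ->
  exists M'' w,
  [/\ is_maximum M'' /\ M'' y = y,
      forall t, M'' t = M t \/ M'' t = M' t,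
      M y = y -> w = y,
      forall t, M t = t -> t != w -> M'' t = t &
      forall x,
        ~~ [exists N, [&& is_maximum N, fixes F N & N x == x]] ->
        ~~ [exists N, [&& is_maximum N, fixes F N & N (M x) == M x]] ->
        M'' x = M x].
Proof.
move=> hM; have [n] := ubnP #|finset (fun t => M t != M' t)|.
elim: n M' y => // n IH M' y hn hM' FM FM' My'.
have [My|nMy] := eqVneq (M y) y.
  by exists M, y; split=> //; left.
have mM := is_maximum_matching hM; have mM' := is_maximum_matching hM'.
have MK := matchingK mM; have MK' := matchingK mM'.
set y1 := M y in nMy; have My1 : M y1 = y by rewrite MK.
have ay1 : adj y y1 by apply: matching_adj.
(* Rotating [M'] makes it agree with [M] on the edge [{y, y1}] and moves its unmatched vertex to
   [y2], the next vertex of the path. [M] and [M1] differ at fewer vertices, whence the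
   induction. *)
have [nM'y1 maxM1] := rotate_maximum hM' My' ay1.
set M1 := rotate M' y y1 in maxM1; set y2 := M' y1 in nM'y1.
have My2' : M' y2 = y1 by rewrite /y2 MK'.
have ny2y : y2 != y.
  apply/eqP => e; have : M' y2 = y by rewrite e.
  by rewrite My2' => e'; rewrite e' eqxx in nMy.
have M1y : M1 y = y1 by rewrite ffunE eqxx.
have M1y1 : M1 y1 = y by rewrite ffunE eqxx (negbTE nMy).
have M1y2 : M1 y2 = y2 by rewrite ffunE (negbTE ny2y) (negbTE nM'y1) eqxx.
have M1t t : t != y -> t != y1 -> t != y2 -> M1 t = M' t.
  by move=> *; rewrite ffunE !ifN.
have FM1 : fixes F M1.
  apply/subsetP => s sF; have := subsetP FM s sF; have := subsetP FM' s sF.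
  rewrite !inE => /eqP s' /eqP s0.
  have nsy : s != y by apply/eqP => e; move: nMy; rewrite /y1 -e s0 eqxx.
  have nsy1 : s != y1 by apply/eqP => e; move: My1 nsy; rewrite -e s0 => ->; rewrite eqxx.
  by have [->|ns2] := eqVneq s y2; rewrite ?M1y2 // M1t // s'.
have hn1 : #|finset (fun t => M t != M1 t)| < n.
  rewrite -ltnS; apply: leq_trans hn; rewrite ltnS.
  rewrite (cardsD1 y (finset (fun t => M t != M' t))) inE My' nMy add1n ltnS.
  apply/subset_leq_card/subsetP => t; rewrite !inE.
  have [->|nty] := eqVneq t y; first by rewrite M1y eqxx.
  have [->|nt1] := eqVneq t y1; first by rewrite M1y1 My1 eqxx.
  have [->|nt2] := eqVneq t y2; last by rewrite M1t.
  move=> _ /=; rewrite My2'; apply/eqP => e.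
  by move: ny2y; rewrite -(MK y2) e My1 eqxx.
have [M2 [w [[maxM2 M2y2] M2t hw1 hw2 hx]]] := IH M1 y2 hn1 maxM1 FM FM1 M1y2.
have mM2 := is_maximum_matching maxM2; have M2K := matchingK mM2.
have M2y : M2 y = y1 by case: (M2t y) => ->.
have M2y1 : M2 y1 = y by rewrite -M2y M2K.
have ay2 : adj y2 y1.
  have := @matching_adj _ y1 mM'; rewrite -/y2 adj_sym; apply; exact: nM'y1.
(* Rotating back: [M2] contains [{y, y1}] and misses [y2], so trading that edge for [{y2, y1}]
   misses [y] again. *)
have [_ maxM3] := rotate_maximum maxM2 M2y2 ay2.
set M3 := rotate M2 y2 y1 in maxM3.
have ny12 : y1 != y2 by rewrite eq_sym.
have M3y : M3 y = y by rewrite ffunE M2y1 eq_sym (negbTE ny2y) eq_sym (negbTE nMy) eqxx.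
have M3y1 : M3 y1 = y2 by rewrite ffunE eqxx (negbTE ny12).
have M3y2 : M3 y2 = y1 by rewrite ffunE eqxx.
have M3t t : t != y -> t != y1 -> t != y2 -> M3 t = M2 t.
  by move=> *; rewrite ffunE M2y1 !ifN.
exists M3, w; split=> //.
- move=> t.
  have [->|nty] := eqVneq t y; first by right; rewrite M3y.
  have [->|nt1] := eqVneq t y1; first by right; rewrite M3y1.
  have [->|nt2] := eqVneq t y2; first by right; rewrite M3y2.
  by rewrite M3t //; case: (M2t t) => ->; [left|right; rewrite M1t].
- by move=> e; rewrite /y1 e eqxx in nMy.
- move=> t Mt ntw.
  have nty : t != y by apply/eqP => e; move: nMy; rewrite /y1 -e Mt eqxx.
  have nt1 : t != y1 by apply/eqP => e; move: My1 nty; rewrite -e Mt => ->; rewrite eqxx.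
  have [e|nt2] := eqVneq t y2; last by rewrite M3t //; apply: hw2.
  by move: ntw; rewrite e hw1 ?eqxx // -e.
(* Every [M]-edge switched on the path has an end missed by an intermediate maximum matching that
   fixes [F]; the edges without such an end survive. *)
- move=> x nx nMx.
  have nxy : x != y.
    apply/eqP => e; case/existsP: nx; exists M'.
    by rewrite hM' FM' e My' eqxx.
  have nx1 : x != y1.
    apply/eqP => e; case/existsP: nMx; exists M'.
    by rewrite hM' FM' e My1 My' eqxx.
  have nx2 : x != y2.
    apply/eqP => e; case/existsP: nx; exists M1.
    by rewrite maxM1 FM1 e M1y2 eqxx.
  by rewrite M3t //; apply: hx.
Qed.

(** The case [both_missed v v] says that some maximum matching misses [v], that is, [v] lies in the
    set D of the Gallai-Edmonds decomposition. *)
Definition both_missed u v :=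
  [exists M, [&& is_maximum M, M u == u & M v == v]].

Lemma both_missed_sym : symmetric both_missed.
Proof. by move=> u v; apply: eq_existsb => M; rewrite [(_ == u) && _]andbC. Qed.

Lemma both_missedP u v :
  reflect (exists M, [/\ is_maximum M, M u = u & M v = v]) (both_missed u v).
Proof.
apply: (iffP existsP) => [[M /and3P[h /eqP h1 /eqP h2]]|[M [h h1 h2]]]; exists M.
  by [].
by rewrite h h1 h2 !eqxx.
Qed.

Lemma both_missed_nadj u v : both_missed u v -> ~~ adj u v.
Proof.
case/both_missedP => M [hM hu hv]; apply/negP => auv.
by have [] := rotate_maximum hM hu auv; rewrite hv eqxx.
Qed.

(* Gallai's lemma. *)
Lemma both_missed_trans v u w : both_missed v v -> u != w ->
  ~~ both_missed u v -> ~~ both_missed v w -> ~~ both_missed u w.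
Proof.
case/both_missedP => M' [hM' hv _] nuw nuv nvw; apply/negP => /both_missedP[M [hM hu hw]].
have F0 f : fixes set0 f by rewrite /fixes sub0set.
(* Switching [M] so as to miss [v] costs at most one vertex [z] missed by [M]; one of [u] and [w]
   differs from [z] and is then missed together with [v]. *)
have [M2 [z [[hM2 M2v] _ _ h _]]] := exchange hM hM' (F0 _) (F0 _) hv.
have [e|nuz] := eqVneq u z; last first.
  by case/negP: nuv; apply/both_missedP; exists M2; rewrite (h u).
by case/negP: nvw; apply/both_missedP; exists M2; rewrite (h w) // -e eq_sym.
Qed.

Definition ext_nbhd (U : {set V}) : {set V} :=
  finset (fun x => [exists y in U, adj y x]) :\: U.

Definition missed_with v : {set V} := finset (fun t => (t != v) && both_missed v t).

(** Otherwise take a neighbour [y] of [x] in the set and switch [M] to miss [y] while still missing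
    [v]. The edge [{x, M x}] survives by the last clause of [exchange], used with [F] the singleton
    of [v]; rotating at [y] then misses [M x] together with [v]. *)
Lemma missed_with_partner v M x : is_maximum M -> M v = v ->
  x \in ext_nbhd (missed_with v) -> (M x != x) && (M x \in missed_with v).
Proof.
move=> hM hv; rewrite inE => /andP[xU]; rewrite inE => /exists_inP[y yU ayx].
have [fv Fv] : (forall f : {ffun V -> V}, f v = v -> fixes [set v] f) *
               (forall f, fixes [set v] f -> f v = v).
  split=> f; first by move=> e; rewrite /fixes sub1set inE e.
  by rewrite /fixes sub1set inE => /eqP.
move: (yU); rewrite inE => /andP[nyv byv].
have nxv : x != v.
  by apply/eqP => e; have := both_missed_nadj byv; rewrite adj_sym -e ayx.
have nbx : ~~ both_missed v x by move: xU; rewrite inE nxv.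
have Mx : M x != x.
  by apply: contra nbx => /eqP e; apply/both_missedP; exists M.
rewrite Mx /=; apply/negPn/negP => MxU.
have nMxv : M x != v.
  apply/eqP => e; have := matchingK (is_maximum_matching hM) x.
  by rewrite e hv => e'; rewrite e' eqxx in nxv.
have nbMx : ~~ both_missed v (M x) by move: MxU; rewrite inE nMxv.
have [M' [hM' M'v M'y]] := both_missedP _ _ byv.
have [M2 [w [[hM2 M2y] M2t _ _ h]]] := exchange hM hM' (fv _ hv) (fv _ M'v) M'y.
have M2v : M2 v = v by case: (M2t v) => ->.
have M2x : M2 x = M x.
  apply: h; apply/existsP => -[N /and3P[hN /Fv Nv /eqP Nx]].
    by case/negP: nbx; apply/both_missedP; exists N.
  by case/negP: nbMx; apply/both_missedP; exists N.
have [_ hM3] := rotate_maximum hM2 M2y ayx.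
case/negP: nbMx; apply/both_missedP; exists (rotate M2 y x); split=> //.
  rewrite ffunE eq_sym (negbTE nyv) eq_sym (negbTE nxv) M2x eq_sym.
  by rewrite (negbTE nMxv) M2v.
rewrite ffunE M2x eqxx (negbTE Mx) ifN //.
apply/eqP => e; have := matchingK (is_maximum_matching hM2) x.
by rewrite M2x e M2y => e'; rewrite e' adj_irr in ayx.
Qed.

(** [f] exchanges the vertices matched to one of larger rank with those matched to one of smaller
    rank. *)
Lemma even_matched f : is_matching f -> ~~ odd #|~: unmatched f|.
Proof.
move=> mf; have fK := matchingK mf.
pose lo := finset (fun x => enum_rank x < enum_rank (f x)).
pose hi := finset (fun x => enum_rank (f x) < enum_rank x).
have eU : ~: unmatched f = lo :|: hi.
  apply/setP => x; rewrite !inE -neq_ltn; congr negb.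
  by rewrite -(inj_eq (@enum_rank_inj V)) -val_eqE eq_sym.
have eh : hi = f @: lo.
  apply/setP => x; apply/idP/imsetP => [|[z zl ->]]; last by rewrite !inE fK in zl *.
  by rewrite inE => hx; exists (f x); rewrite ?fK // inE fK.
have d0 : lo :&: hi = set0.
  apply/setP => x; rewrite !inE; apply/negbTE/negP => /andP[a b].
  by have := ltn_trans a b; rewrite ltnn.
by rewrite eU cardsU d0 cards0 subn0 eh card_imset ?addnn ?odd_double //; apply: inv_inj.
Qed.

Lemma perfect_of_unmatched0 f : is_matching f -> unmatched f = set0 ->
  has_perfect_matching adj.
Proof.
move=> mf f0; have fK := matchingK mf.
have nf x : f x != x by have := in_set0 x; rewrite -f0 inE => ->.
apply/existsP; exists [set [set x; f x] | x in [set: V]].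
have pE x z : z \in [set x; f x] -> [set z; f z] = [set x; f x].
  by rewrite !inE => /orP[]/eqP-> //; rewrite fK setUC.
apply/and3P; split.
- apply/subsetP => A /imsetP[x _ ->]; apply/imsetP; exists (x, f x) => //.
  by rewrite inE /=; apply: matching_adj.
- apply/trivIsetP => A B /imsetP[x _ ->] /imsetP[y _ ->]; apply: contraNT.
  by case/pred0Pn => z /= /andP[/pE <- /pE <-].
- apply/eqP/setP => x; rewrite inE; apply/bigcupP; exists [set x; f x].
    by apply: imset_f.
  by rewrite !inE eqxx.
Qed.

(** By parity a maximum matching missing [v] also misses some [t != v]. It injects the neighbourhood
    into [missed_with v], and [t] is not in the image. *)
Lemma ext_nbhd_missed_with v : ~~ odd #|V| -> both_missed v v ->
  #|ext_nbhd (missed_with v)| < #|missed_with v|.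
Proof.
move=> eV /both_missedP[M [hM Mv _]].
have mM := is_maximum_matching hM.
have [t tv Mt] : exists2 t, t != v & M t = t.
  have vU : v \in unmatched M by rewrite inE Mv.
  have := even_matched mM; have := cardsC (unmatched M).
  rewrite (cardsD1 v) vU => hc ho.
  have : unmatched M :\ v != set0.
    apply/eqP => e; move: hc; rewrite e cards0 => hc.
    by move: eV ho; rewrite -hc oddD /=; case: (odd _).
  by case/set0Pn => t; rewrite !inE => /andP[? /eqP ?]; exists t.
have tU : t \in missed_with v.
  by rewrite inE tv; apply/both_missedP; exists M.
rewrite -(card_imset (mem (ext_nbhd (missed_with v))) (inv_inj (matchingK mM))).
rewrite (cardsD1 t (missed_with v)) tU add1n ltnS.
apply/subset_leq_card/subsetP => z /imsetP[x xU ->].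
have /andP[h1 h2] := missed_with_partner hM Mv xU.
rewrite in_setD1 h2 andbT; apply/eqP => e.
by have := matchingK mM x; rewrite e Mt => e'; move: h1; rewrite -e' Mt eqxx.
Qed.

(** If a maximum matching misses some vertex, then for each [v] in [D] the set [U = missed_with v]
    fails to expand, so it has at least [h] elements. No edge joins [U] to the complement of [U] and
    its neighbourhood, nor to the class [K v], so these have fewer than [h] elements. Hence [D] has
    at least [3 * h] elements while its classes are smaller than [h]: some union of classes has
    between [h] and [2 * h] elements, leaves at least [h] others in [D], and no edge joins the two
    parts. *)
Theorem expander_perfect_matching (h : nat) : ~~ odd #|V| -> 0 < h -> 7 * h <= #|V| ->
  (forall U : {set V}, 0 < #|U| < h -> #|U| <= #|ext_nbhd U|) ->
  (forall X Y : {set V}, [disjoint X & Y] -> h <= #|X| -> h <= #|Y| ->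
     exists x y, [/\ x \in X, y \in Y & adj x y]) ->
  has_perfect_matching adj.
Proof.
move=> eV h0 h7 hsmall hbig.
have [M hM] := exists_maximum.
have [e|/set0Pn[v0 v0M]] := eqVneq (unmatched M) set0.
  exact: perfect_of_unmatched0 (is_maximum_matching hM) e.
pose D := finset (fun v => both_missed v v).
pose K v := D :\: missed_with v.
have v0D : v0 \in D.
  by rewrite inE; apply/both_missedP; exists M; move: v0M; rewrite inE => /eqP.
have UD v : missed_with v \subset D.
  apply/subsetP => t; rewrite !inE => /andP[_ /both_missedP[N [? _ ?]]].
  by apply/both_missedP; exists N.
have Ubig v : v \in D -> #|V| <= 2 * #|missed_with v| + h /\ #|K v| < h.
  move=> vD; have vv : both_missed v v by move: vD; rewrite inE.
  set U := missed_with v; have hU := ext_nbhd_missed_with eV vv; rewrite -/U in hU.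
  have hhU : h <= #|U|.
    rewrite leqNgt; apply/negP => hlt.
    have := hsmall U; rewrite hlt andbT => /(_ (leq_ltn_trans (leq0n _) hU)).
    by rewrite leqNgt hU.
  split.
    rewrite leqNgt; apply/negP => hlt.
    have hR : h <= #|~: (U :|: ext_nbhd U)|.
      have := cardsC (U :|: ext_nbhd U).
      have := leq_card_setU U (ext_nbhd U).
      set a := #|_ :|: _|; set b := #|~: _|; case=> hab _; lia.
    have dis : [disjoint U & ~: (U :|: ext_nbhd U)].
      by rewrite disjoints_subset setCK subsetUl.
    have [x [y [xU]]] := hbig _ _ dis hhU hR.
    rewrite in_setC in_setU negb_or in_setD => /andP[yU]; rewrite yU inE /=.
    by move=> /existsP yn axy; case: yn; exists x; rewrite xU.
  rewrite ltnNge; apply/negP => hlt.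
  have dis : [disjoint K v & U].
    by rewrite disjoint_sym disjoints_subset; apply/subsetP => t tU; rewrite in_setC in_setD tU.
  have [x [y [xK yU axy]]] := hbig _ _ dis hlt hhU.
  move: xK yU; rewrite in_setD !inE negb_and negbK => /andP[hx xx] /andP[nyv vy].
  have nxy : ~~ both_missed x y by apply: contraL axy; apply: both_missed_nadj.
  case: (eqVneq x v) hx => [e _|nxv /= hx]; first by rewrite -e (negbTE nxy) in vy.
  by move: vy; apply/negP; apply: (both_missed_trans xx); rewrite // eq_sym.
(* [~~ both_missed] is an equivalence relation on [D] whose classes are the sets
   [K v], and no edge inside [D] joins two classes. *)
pose closed (X : {set V}) := (X \subset D) &&
  [forall x in X, forall y in D, ~~ both_missed x y ==> (y \in X)].
have clP X : closed X -> forall x y, x \in X -> y \in D -> ~~ both_missed x y -> y \in X.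
  case/andP => _ /forall_inP H x y xX yD hxy.
  by have /forall_inP/(_ _ yD)/implyP := H x xX; apply.
have [D1 D2] := Ubig _ v0D.
have DU : #|missed_with v0| <= #|D| by apply: subset_leq_card.
have hD : closed D && (h <= #|D|).
  apply/andP; split; last by lia.
  by rewrite /closed subxx; apply/forall_inP => x _; apply/forall_inP => y ->; rewrite implybT.
pose X := [arg min_(X < D | closed X && (h <= #|X|)) #|X|].
have [clX hX minX] : [/\ closed X, h <= #|X| &
    forall Y, closed Y -> h <= #|Y| -> #|X| <= #|Y|].
  rewrite /X; case: arg_minnP => // Y /andP[? ?] m; split=> // Z ? ?.
  by apply: m; apply/andP.
have XD : X \subset D by case/andP: clX.
have [v vX] : exists v, v \in X by apply/set0Pn; rewrite -card_gt0; lia.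
have vD := subsetP XD _ vX; have [_ Kv] := Ubig v vD.
have X2 : #|X| < 2 * h.
  have cl' : closed (X :\: K v).
    apply/andP; split; first exact: subset_trans (subsetDl _ _) XD.
    apply/forall_inP => x; rewrite in_setD => /andP[xK xX].
    apply/forall_inP => y yD; apply/implyP => hxy.
    rewrite in_setD (clP _ clX x) // andbT.
    have xD := subsetP XD _ xX.
    move: xK; rewrite in_setD xD andbT negbK inE => /andP[nxv bvx].
    apply/negP; rewrite in_setD yD andbT inE negb_and negbK => /orP[/eqP e|nvy].
      by rewrite e both_missed_sym bvx in hxy.
    move: bvx; apply/negP; apply: (both_missed_trans (v := y)) => //; rewrite 1?eq_sym //.
      by rewrite inE in yD.
    by rewrite both_missed_sym.
  have lt : #|X :\: K v| < h.
    rewrite ltnNge; apply/negP => hle; have := minX _ cl' hle.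
    apply/negP; rewrite -ltnNge (cardsD1 v X) vX add1n ltnS.
    apply/subset_leq_card/subsetP => t; rewrite !inE => /andP[tK tX].
    by rewrite tX andbT; apply: contra tK => /eqP ->; rewrite eqxx /= inE in vD *.
  rewrite -(cardsID (K v) X) mul2n -addnn -addSn; apply: leq_add; last exact: ltnW.
  by apply: leq_ltn_trans Kv; apply/subset_leq_card/subsetIr.
have dis : [disjoint X & D :\: X].
  by rewrite disjoint_sym disjoints_subset; apply/subsetP => t; rewrite !inE => /andP[].
have hY : h <= #|D :\: X| by rewrite cardsDS //; move: D1 DU X2 h7; clear; lia.
have [x [y [xX]]] := hbig _ _ dis hX hY.
rewrite inE => /andP[yX yD] axy; case/negP: yX; apply: (clP _ clX x) => //.
by apply: contraL axy; apply: both_missed_nadj.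
Qed.

Lemma perfect_matching_nisolated : has_perfect_matching adj ->
  forall v, exists w, adj v w.
Proof.
case/existsP => P /and3P[/subsetP hP _ /eqP cP] v.
have : v \in cover P by rewrite cP inE.
case/bigcupP => e /hP /imsetP[[a b]]; rewrite inE /= => ab ->.
by rewrite !inE => /orP[]/eqP->; [exists b|exists a; rewrite adj_sym].
Qed.

End Matching.

(** * Expansion in unions of cliques *)

Lemma has_perfect_matching_mono (V : finType) (e e' : rel V) : subrel e e' ->
  has_perfect_matching e -> has_perfect_matching e'.
Proof.
move=> h /existsP[M /and3P[h1 h2 h3]]; apply/existsP; exists M; rewrite /perfect_matching h2 h3 !andbT.
apply: fintype.subset_trans h1 _; apply/fintype.subsetP => A /imsetP[[x y]] /= xy ->.
by apply/imsetP; exists (x, y) => //=; apply: h.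
Qed.

Section CliqueCover.
Import mathcomp.boot.fintype mathcomp.boot.finset.
Local Open Scope set_scope.
Variables (V I : finType).
Implicit Types (f : {ffun I -> {set V}}) (C T U X Y : {set V}).

Definition share f : rel V :=
  fun v w => (v != w) && [exists i, (v \in f i) && (w \in f i)].

Lemma share_sym f : symmetric (share f).
Proof.
move=> v w; rewrite /share eq_sym; congr (_ && _).
by apply: eq_existsb => i; rewrite andbC.
Qed.

Lemma share_irr f : irreflexive (share f).
Proof. by move=> v; rewrite /share eqxx. Qed.

Lemma in_ext_nbhd (adj : rel V) U x :
  (x \in ext_nbhd adj U) = (x \notin U) && [exists y in U, adj y x].
Proof. by rewrite in_setD inE. Qed.

(** Stated feature by feature, so that its probability is a product. *)
Definition separated f X Y :=
  [forall i, [disjoint f i & X] || [disjoint f i & Y]].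

Lemma separatedP f X Y : [disjoint X & Y] ->
  reflect (forall x y, x \in X -> y \in Y -> ~~ share f x y) (separated f X Y).
Proof.
move=> dXY; apply: (iffP forallP) => [h x y xX yY|h i].
  apply/negP => /andP[_ /existsP[i /andP[xi yi]]].
  by case/orP: (h i) => /disjointFr; [move/(_ _ xi); rewrite xX|move/(_ _ yi); rewrite yY].
apply/negPn/negP; rewrite negb_or => /andP[/pred0Pn[x /andP[/= xi xX]] /pred0Pn[y /andP[/= yi yY]]].
case/negP: (h x y xX yY); apply/andP; split; last by apply/existsP; exists i; rewrite xi.
by apply/eqP => e; have := disjointFr dXY xX; rewrite e yY.
Qed.

(* The subtraction is truncated. *)
Definition excess f T := \sum_i (#|f i :&: T| - 1).

Lemma excess_grow f C v w : w \in C -> v \notin C -> share f w v ->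
  excess f C < excess f (v |: C).
Proof.
move=> wC vC /andP[_ /existsP[i /andP[wi vi]]].
rewrite /excess (bigD1 i) //= [leqRHS](bigD1 i) //= -addSn; apply: leq_add; last first.
  by apply: leq_sum => j _; apply/leq_sub2r/subset_leq_card/setIS/subsetUr.
have -> : f i :&: (v |: C) = v |: (f i :&: C).
  by apply/setP => x; rewrite !inE; case: eqVneq => // ->; rewrite vi.
rewrite cardsU1 inE (negbTE vC) andbF /=.
have : 0 < #|f i :&: C| by apply/card_gt0P; exists w; rewrite inE wi.
lia.
Qed.

(* A smallest non-expanding set induces, together with its neighbourhood, a
   connected hypergraph, and connectedness costs an excess of [#|T| - 1]. *)
Lemma small_expansion f (h : nat) :
  (forall v, exists w, share f v w) ->
  (forall U T, U \subset T -> #|T| < 2 * #|U| -> 1 < #|U| < h ->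
     separated f U (~: T) -> #|T| <= (excess f T).+1 -> False) ->
  forall U, 0 < #|U| < h -> #|U| <= #|ext_nbhd (share f) U|.
Proof.
move=> niso bad U; have [n] := ubnP #|U|; elim: n U => // n IH U hn /andP[U0 Uh].
rewrite leqNgt; apply/negP => hU.
set T := U :|: ext_nbhd (share f) U.
have dU : [disjoint U & ext_nbhd (share f) U].
  by rewrite disjoint_sym disjoints_subset; apply/subsetP => x; rewrite in_setD in_setC => /andP[].
have cT : #|T| = #|U| + #|ext_nbhd (share f) U|.
  by have := leq_card_setU U (ext_nbhd (share f) U); rewrite dU => /leqifP/eqP.
have extT x y : y \in U -> share f y x -> x \in T.
  move=> yU yx; rewrite in_setU in_setD; case: (x \in U) => //=.
  by rewrite inE; apply/existsP; exists y; rewrite yU.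
have sep : separated f U (~: T).
  apply/separatedP; first by rewrite disjoints_subset setCK subsetUl.
  move=> x y xU; rewrite in_setC; apply: contra => xy; exact: extT xy.
have U1 : 1 < #|U|.
  rewrite ltn_neqAle U0 andbT eq_sym; apply/negP => /cards1P[v Uv].
  have [w vw] := niso v.
  have : 0 < #|ext_nbhd (share f) U|.
    apply/card_gt0P; exists w; rewrite in_setD Uv in_set1 inE.
    apply/andP; split; first by apply: contraTneq vw => ->; rewrite share_irr.
    by apply/existsP; exists v; rewrite in_set1 eqxx.
  by move: hU; rewrite Uv cards1; case: #|_|.
have T2 : #|T| < 2 * #|U| by rewrite cT mul2n -addnn ltn_add2l.
apply: (bad U T) => //; rewrite ?subsetUl ?U1 //.
have [u0 u0U] : exists u0, u0 \in U by apply/card_gt0P.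
(* [good] asks for the excess that connectivity would give rather than for connectivity. A [good]
   set of largest cardinality has no edge to the rest of [T], since such an edge would extend it. *)
pose good C := [&& C \subset T, C != set0 & #|C| <= (excess f C).+1].
have g0 : good [set u0].
  apply/and3P; split; rewrite ?cards1 //; first by rewrite sub1set in_setU u0U.
  by apply/set0Pn; exists u0; rewrite in_set1.
pose C := [arg max_(C > [set u0] | good C) #|C|].
have [/and3P[CT C0 Cex] maxC] : good C /\ forall C', good C' -> #|C'| <= #|C|.
  by rewrite /C; case: arg_maxnP.
suff -> : T = C by [].
apply/eqP; rewrite eqEsubset CT andbT; apply/negPn/negP => nTC.
have noedge c v : c \in C -> v \in T :\: C -> ~~ share f c v.
  move=> cC; rewrite in_setD => /andP[vC vT]; apply/negP => cv.
  have := maxC (v |: C); rewrite cardsU1 vC add1n ltnn => Hg; suff: false by []; apply: Hg.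
  apply/and3P; split; first by rewrite subUset sub1set vT.
    by apply/set0Pn; exists v; rewrite in_setU in_set1 eqxx.
  by rewrite cardsU1 vC add1n ltnS; apply: leq_trans Cex (excess_grow cC vC cv).
have inext x : x \in T -> x \notin U -> exists2 y, y \in U & share f y x.
  rewrite in_setU in_setD inE => /orP[->//|/andP[_ /exists_inP[y ? ?]]] _.
  by exists y.
(* With no edge between [C] and [T :\: C], the two parts of [U] have disjoint neighbourhoods. Both
   are nonempty because every vertex of [T] outside [U] has a neighbour in [U]; both expand by
   induction, and adding up contradicts the choice of [U]. *)
set A := U :&: C; set A' := U :\: C.
have eA : ext_nbhd (share f) A \subset C :\: U.
  apply/subsetP => x; rewrite in_ext_nbhd => /andP[xA /exists_inP[y /setIP[yU yC] yx]].
  have xT := extT _ _ yU yx.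
  have xC : x \in C.
    apply/negPn/negP => xC; have := noedge y x yC; rewrite in_setD xC xT yx.
    by move/(_ isT).
  by rewrite in_setD xC andbT; apply: contra xA => xU; rewrite in_setI xU.
have eA' : ext_nbhd (share f) A' \subset (T :\: C) :\: U.
  apply/subsetP => x; rewrite in_ext_nbhd => /andP[xA /exists_inP[y /setDP[yU yC] yx]].
  have xT := extT _ _ yU yx.
  have xC : x \notin C.
    apply/negP => xC; have := noedge x y xC; rewrite in_setD yC in_setU yU share_sym yx.
    by move/(_ isT).
  by rewrite !in_setD xC xT !andbT; apply: contra xA => xU; rewrite in_setD xU xC.
have A0 : 0 < #|A|.
  rewrite card_gt0; apply/eqP => A0; have [c cC] := set0Pn _ C0.
  have cU : c \notin U by apply/negP => cU; have := in_set0 c; rewrite -A0 in_setI cU cC.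
  have [y yU yc] := inext c (subsetP CT _ cC) cU.
  have yC : y \notin C by apply/negP => yC; have := in_set0 y; rewrite -A0 in_setI yU yC.
  by have := noedge c y cC; rewrite in_setD yC in_setU yU share_sym yc; move/(_ isT).
have A'0 : 0 < #|A'|.
  rewrite card_gt0; apply/eqP => A'0.
  have [c cT' cC] := subsetPn nTC.
  have cU : c \notin U by apply/negP => cU; have := in_set0 c; rewrite -A'0 in_setD cU cC.
  have [y yU yc] := inext c cT' cU.
  have yC : y \in C.
    by apply/negPn/negP => yC; have := in_set0 y; rewrite -A'0 in_setD yU yC.
  by have := noedge y c yC; rewrite in_setD cC cT' yc; move/(_ isT).
have cU : #|A| + #|A'| = #|U| by rewrite cardsID.
have hA : #|A| <= #|ext_nbhd (share f) A|.
  apply: IH; last rewrite A0 /=; move: hn Uh cU A'0; clear; lia.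
have hA' : #|A'| <= #|ext_nbhd (share f) A'|.
  apply: IH; last rewrite A'0 /=; move: hn Uh cU A0; clear; lia.
have := subset_leq_card eA; have := subset_leq_card eA'.
have : #|C :\: U| + #|(T :\: C) :\: U| = #|T :\: U|.
  rewrite -(cardsID C (T :\: U)); congr (_ + _).
    apply: eq_card => x; rewrite !in_setI !in_setD; case xC : (x \in C); rewrite ?andbF //.
    by rewrite (subsetP CT _ xC) !andbT.
  by apply: eq_card => x; rewrite !in_setD; case: (x \in C); rewrite ?andbF.
have : #|T :\: U| <= #|ext_nbhd (share f) U|.
  by apply/subset_leq_card/subsetP => x; rewrite in_setD in_setU => /andP[/negbTE->].
move: hA hA' cU hU; clear; lia.
Qed.

(** Larger sets contain sets of exactly [h] vertices, so the second bad event only concerns pairs of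
    one size. *)
Lemma separated_perfect_matching f (h : nat) : ~~ odd #|V| -> 0 < h -> 7 * h <= #|V| ->
  (forall v, exists w, share f v w) ->
  (forall U T, U \subset T -> #|T| < 2 * #|U| -> 1 < #|U| < h ->
     separated f U (~: T) -> #|T| <= (excess f T).+1 -> False) ->
  (forall X Y, #|X| = h -> #|Y| = h -> [disjoint X & Y] -> separated f X Y -> False) ->
  has_perfect_matching (share f).
Proof.
move=> eV h0 h7 niso bad1 bad2.
apply: (expander_perfect_matching (share_sym f) (@share_irr f) eV h0 h7).
  exact: small_expansion niso bad1.
move=> X Y dXY hX hY.
have subh (Z : {set V}) : h <= #|Z| -> exists2 Z' : {set V}, Z' \subset Z & #|Z'| = h.
  move=> /card_geqP[s [us ss sZ]]; exists [set x in s].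
    by apply/subsetP => x; rewrite inE => /sZ.
  by rewrite cardsE (card_uniqP us).
have [X' sX cX] := subh X hX; have [Y' sY cY] := subh Y hY.
have d' : [disjoint X' & Y'] by apply: disjointWl sX (disjointWr sY dXY).
apply: contrapT => hno; apply: (bad2 X' Y' cX cY d').
apply/(separatedP _ d') => x y xX yY; apply/negP => xy; apply: hno.
by exists x, y; rewrite (subsetP sX) ?(subsetP sY).
Qed.

End CliqueCover.

(** * The product space of random cliques *)

Section PowerBounds.
Variable R : realType.
Implicit Types (x y p z : R) (n k : nat).
Local Open Scope ring_scope.

Lemma bernoulli_sub p n : 0 <= p <= 1 -> 1 - n%:R * p <= (1 - p) ^+ n.
Proof.
case/andP=> p0 p1; elim: n => [|n IH]; first by rewrite expr0 mul0r subr0.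
rewrite exprS -natr1; have h : 0 <= 1 - p by lra.
apply: le_trans (ler_wpM2l h IH); have : 0 <= n%:R :> R by [].
by nra.
Qed.

Lemma expr_sub_le2 p n : 0 <= p <= 1 -> (1 - p) ^+ n <= 1 - n%:R * p + (n%:R * p) ^+ 2.
Proof.
case/andP=> p0 p1; elim: n => [|n IH]; first by rewrite expr0 mul0r; lra.
rewrite exprS -natr1; have h : 0 <= 1 - p by lra.
apply: le_trans (ler_wpM2l h IH) _; have n0 : 0 <= n%:R :> R by [].
have : 0 <= p ^+ 3 * n%:R ^+ 2 by rewrite mulr_ge0 // ?exprn_ge0.
have : 0 <= p ^+ 2 * n%:R by rewrite mulr_ge0 // ?exprn_ge0.
have : 0 <= p ^+ 2 by rewrite exprn_ge0.
by nra.
Qed.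

Lemma expr_add_le2 y n : 0 <= y -> n%:R * y <= 1 ->
  (1 + y) ^+ n <= 1 + n%:R * y + (n%:R * y) ^+ 2.
Proof.
move=> y0; elim: n => [|n IH]; first by rewrite expr0 mul0r; lra.
rewrite exprS -natr1 => hn; have n0 : 0 <= n%:R :> R by [].
have ny : n%:R * y <= 1 by nra.
have h : 0 <= 1 + y by lra.
apply: le_trans (ler_wpM2l h (IH ny)) _.
have : n%:R ^+ 2 * y ^+ 3 <= n%:R * y ^+ 2.
  have : 0 <= n%:R * y ^+ 2 by rewrite mulr_ge0 ?exprn_ge0.
  by nra.
have : 0 <= n%:R * y ^+ 2 by rewrite mulr_ge0 ?exprn_ge0.
have : 0 <= y ^+ 2 by rewrite exprn_ge0.
by nra.
Qed.

Lemma expr_sub_mul_le1 p n : 0 <= p <= 1 -> (1 - p) ^+ n * (1 + n%:R * p) <= 1.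
Proof.
case/andP=> p0 p1; elim: n => [|n IH]; first by rewrite expr0 mul0r; lra.
rewrite exprSr -natr1; apply: le_trans IH; rewrite -mulrA ler_wpM2l ?exprn_ge0 //; first by lra.
have n0 : 0 <= n%:R :> R by [].
have : 0 <= n%:R * p ^+ 2 by rewrite mulr_ge0 ?exprn_ge0.
have : 0 <= p ^+ 2 by rewrite exprn_ge0.
by nra.
Qed.

Lemma one_sub_expr_ge p n : 0 <= p <= 1 ->
  n%:R * p <= (1 - (1 - p) ^+ n) * (1 + n%:R * p).
Proof. by move=> h; have := expr_sub_mul_le1 n h; lra. Qed.

(** The sequence [1 - x ^+ n] is concave and vanishes at [0], so its quotient by [n] decreases. *)
Lemma one_sub_expr_concave x a b : 0 <= x <= 1 -> (a <= b)%N ->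
  a%:R * (1 - x ^+ b) <= b%:R * (1 - x ^+ a).
Proof.
case/andP=> x0 x1 ab.
have aux n : n%:R * x ^+ n * (1 - x) <= 1 - x ^+ n.
  elim: n => [|n IH]; first by rewrite expr0 !mul0r; lra.
  rewrite exprS -natr1; have h1 : x * (n%:R * x ^+ n * (1 - x)) <= x * (1 - x ^+ n).
    by rewrite ler_wpM2l.
  have h2 : 0 <= (1 - x) * (1 - x * x ^+ n).
    by rewrite mulr_ge0 // subr_ge0 // -exprS ?exprn_ile1.
  by lra.
elim: b ab => [|b IH]; first by rewrite leqn0 => /eqP ->.
rewrite leq_eqVlt => /orP[/eqP-> //|]; rewrite ltnS => ab.
have h := IH ab; have h2 := aux a.
have h3 : x ^+ b <= x ^+ a by apply: ler_wiXn2l; rewrite ?x0.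
have a0 : 0 <= a%:R * (1 - x) by rewrite mulr_ge0 //; lra.
have h4 := ler_wpM2l a0 h3.
by rewrite exprS -natr1; lra.
Qed.

End PowerBounds.

(** * Probabilities of events that factorize over the features *)

Section ProductSpace.
Import mathcomp.boot.fintype mathcomp.boot.finset.
Local Open Scope set_scope.
Local Open Scope ring_scope.
Variables (R : realType) (V I : finType).
Implicit Types (p : I -> R) (r x z : R) (f : {ffun I -> {set V}}) (A K T U X Y : {set V}).
Implicit Types (E : pred {ffun I -> {set V}}) (g h : {ffun I -> {set V}} -> R).

(** Law of the vertex set of one feature of density [r]. Outcomes are indexed by features and not by
    vertices because the basic events below are conjunctions of one condition per feature. *)
Definition vmass r A : R := \prod_v (if v \in A then r else 1 - r).
Definition mass p f : R := \prod_i vmass (p i) (f i).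
Definition Ex p g : R := \sum_f mass p f * g f.
Definition Pr p E : R := Ex p (fun f => (E f)%:R).

Lemma vmass_ge0 r A : 0 <= r <= 1 -> 0 <= vmass r A.
Proof. by case/andP=> r0 r1; apply: prodr_ge0 => v _; case: ifP => _; lra. Qed.

Lemma vmass_prod r (x y : V -> R) :
  \sum_A vmass r A * (\prod_v (if v \in A then x v else y v)) =
  \prod_v (r * x v + (1 - r) * y v).
Proof.
rewrite bigA_distr; apply: eq_bigr => A _.
by rewrite -big_split /=; apply: eq_bigr => v _; case: ifP.
Qed.

Lemma vmass_sum r : \sum_A vmass r A = 1.
Proof.
transitivity (\sum_A vmass r A * (\prod_v (if v \in A then 1 else 1))).
  by apply: eq_bigr => A _; rewrite big1 ?mulr1 // => v; case: ifP.
by rewrite vmass_prod big1 // => v _; rewrite !mulr1; lra.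
Qed.

Lemma mass_ge0 p f : (forall i, 0 <= p i <= 1) -> 0 <= mass p f.
Proof. by move=> hp; apply: prodr_ge0 => i _; apply: vmass_ge0. Qed.

Lemma Ex_prod p (g : I -> {set V} -> R) :
  Ex p (fun f => \prod_i g i (f i)) = \prod_i \sum_A vmass (p i) A * g i A.
Proof.
rewrite bigA_distr_bigA; apply: eq_bigr => f _.
by rewrite /mass -big_split.
Qed.

Lemma Ex_le p g h : (forall i, 0 <= p i <= 1) -> (forall f, g f <= h f) ->
  Ex p g <= Ex p h.
Proof. by move=> hp gh; apply: ler_sum => f _; rewrite ler_wpM2l ?mass_ge0. Qed.

Lemma eq_Ex p g h : g =1 h -> Ex p g = Ex p h.
Proof. by move=> e; apply: eq_bigr => f _; rewrite e. Qed.

Lemma Ex_sum p (J : Type) (s : seq J) (P : pred J) (g : J -> {ffun I -> {set V}} -> R) :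
  Ex p (fun f => \sum_(j <- s | P j) g j f) = \sum_(j <- s | P j) Ex p (g j).
Proof.
rewrite exchange_big; apply: eq_bigr => f _; by rewrite mulr_sumr.
Qed.

Lemma ExZ p c g : Ex p (fun f => c * g f) = c * Ex p g.
Proof. by rewrite mulr_sumr; apply: eq_bigr => f _; rewrite mulrCA. Qed.

Lemma ExD p g h : Ex p (fun f => g f + h f) = Ex p g + Ex p h.
Proof. by rewrite -big_split; apply: eq_bigr => f _; rewrite mulrDr. Qed.

Lemma Ex_cst p c : Ex p (fun=> c) = c.
Proof.
rewrite /Ex -mulr_suml; have -> : \sum_f mass p f = 1; last by rewrite mul1r.
rewrite -(bigA_distr_bigA (fun i => vmass (p i))).
by rewrite big1 // => i _; apply: vmass_sum.
Qed.

Lemma Pr_le p E E' : (forall i, 0 <= p i <= 1) -> (forall f, E f -> E' f) -> Pr p E <= Pr p E'.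
Proof.
move=> hp h; apply: Ex_le => // f; rewrite ler_nat.
by case: (E f) (h f) => // /(_ isT) ->.
Qed.

Lemma Pr_ge0 p E : (forall i, 0 <= p i <= 1) -> 0 <= Pr p E.
Proof. by move=> hp; rewrite -(Ex_cst p 0); apply: Ex_le. Qed.

Lemma Pr_le1 p E : (forall i, 0 <= p i <= 1) -> Pr p E <= 1.
Proof.
by move=> hp; rewrite -[leRHS](Ex_cst p 1); apply: Ex_le => // f; rewrite lern1; case: (E f).
Qed.

Lemma Pr_exists p (J : finType) (Q : pred J) (E : J -> pred {ffun I -> {set V}}) :
  (forall i, 0 <= p i <= 1) ->
  Pr p (fun f => [exists j, Q j && E j f]) <= \sum_(j | Q j) Pr p (E j).
Proof.
move=> hp; rewrite -Ex_sum; apply: Ex_le => // f.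
case: existsP => [[j /andP[Qj Ej]]|_]; last by rewrite sumr_ge0.
by rewrite (bigD1 j) //= Ej lerDl sumr_ge0.
Qed.

Lemma prod_natb (J : finType) (P : pred J) : \prod_j (P j)%:R = [forall j, P j]%:R :> R.
Proof.
case: forallP => [h|/forallP]; first by rewrite big1 // => j _; rewrite h.
by rewrite negb_forall => /existsP[j /negbTE nj]; rewrite (bigD1 j) //= nj mul0r.
Qed.

Lemma vmass_power r z T :
  \sum_A vmass r A * z ^+ #|A :&: T| = (1 + r * (z - 1)) ^+ #|T|.
Proof.
transitivity (\sum_A vmass r A *
    (\prod_v (if v \in A then (if v \in T then z else 1) else 1))).
  apply: eq_bigr => A _; congr (_ * _).
  rewrite -big_mkcond -big_mkcondr /= -prodr_const.
  by apply: eq_bigl => v; rewrite inE.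
rewrite vmass_prod -[RHS]prodr_const [RHS]big_mkcond.
by apply: eq_bigr => v _; case: ifP => _; lra.
Qed.

Lemma vmass_disjoint r T : \sum_A vmass r A * [disjoint A & T]%:R = (1 - r) ^+ #|T|.
Proof.
have -> : 1 - r = 1 + r * (0 - 1) by lra.
rewrite -vmass_power; apply: eq_bigr => A _; congr (_ * _).
by rewrite -setI_eq0 -cards_eq0; case: #|_| => [|n]; rewrite ?expr0 ?exprS ?mul0r.
Qed.

(** Probability that a feature of density [r] meets both of two disjoint sets of [x] and [y]
    vertices. *)
Definition contact r (x y : nat) : R := (1 - (1 - r) ^+ x) * (1 - (1 - r) ^+ y).

Lemma vmass_separated r X Y : [disjoint X & Y] ->
  \sum_A vmass r A * ([disjoint A & X] || [disjoint A & Y])%:R = 1 - contact r #|X| #|Y|.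
Proof.
move=> dXY.
have cU : #|X :|: Y| = (#|X| + #|Y|)%N.
  by have := leq_card_setU X Y; rewrite dXY => /leqifP/eqP.
transitivity (\sum_A (vmass r A * [disjoint A & X]%:R + vmass r A * [disjoint A & Y]%:R
                 - vmass r A * [disjoint A & X :|: Y]%:R)).
  apply: eq_bigr => A _; rewrite -mulrDr -mulrBr; congr (_ * _).
  have -> : [disjoint A & X :|: Y] = [disjoint A & X] && [disjoint A & Y].
    by rewrite -!setI_eq0 setIUr setU_eq0.
  by case: [disjoint A & X]; case: [disjoint A & Y] => /=; lra.
rewrite sumrB big_split /= !vmass_disjoint cU exprD /contact; ring.
Qed.

Lemma Pr_separated p X Y : [disjoint X & Y] ->
  Pr p (fun f => separated f X Y) = \prod_i (1 - contact (p i) #|X| #|Y|).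
Proof.
move=> dXY.
transitivity (Ex p (fun f => \prod_i ([disjoint f i & X] || [disjoint f i & Y])%:R)).
  by apply: eq_Ex => f; rewrite prod_natb.
rewrite (Ex_prod p (fun _ A => ([disjoint A & X] || [disjoint A & Y])%:R)).
by apply: eq_bigr => i _; apply: vmass_separated.
Qed.

Lemma prod_le_expR (x : I -> R) : (forall i, 0 <= 1 + x i) ->
  \prod_i (1 + x i) <= expR (\sum_i x i).
Proof. by move=> h; rewrite expR_sum; apply: ler_prod => i _; rewrite h expR_ge1Dx. Qed.

Lemma Pr_separated_le p X Y : (forall i, 0 <= p i <= 1) -> [disjoint X & Y] ->
  Pr p (fun f => separated f X Y) <= expR (- \sum_i contact (p i) #|X| #|Y|).
Proof.
move=> hp dXY; rewrite Pr_separated // -sumrN; apply: prod_le_expR => i.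
have := vmass_separated (p i) dXY => <-; apply: sumr_ge0 => A _.
by rewrite mulr_ge0 ?vmass_ge0.
Qed.

(** For $X = |A \cap T|$ one has $z^{(X-1)^+} = z^{-1} z^X + (1 - z^{-1}) 1_{X=0}$. Both terms have
    closed expectations whose first-order parts in $|T| r$ cancel, which leaves a quadratic
    error. *)
Lemma vmass_excess r z T : 0 <= r <= 1 -> 1 <= z -> z * #|T|%:R * r <= 1 ->
  \sum_A vmass r A * z ^+ (#|A :&: T| - 1) <= 1 + z * (#|T|%:R * r) ^+ 2.
Proof.
move=> hr z1 zt; have z0 : z != 0 by apply: lt0r_neq0; lra.
have [r0 r1] := andP hr.
set t : R := #|T|%:R in zt *; have t0 : 0 <= t by rewrite /t.
have -> : \sum_A vmass r A * z ^+ (#|A :&: T| - 1) =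
    z^-1 * (1 + r * (z - 1)) ^+ #|T| + (1 - z^-1) * (1 - r) ^+ #|T|.
  rewrite -vmass_power -vmass_disjoint !mulr_sumr -big_split /=.
  apply: eq_bigr => A _; rewrite -setI_eq0 -cards_eq0.
  case: #|_| => [|n]; first by rewrite sub0n !expr0 eqxx -mulrDl addrC subrK mul1r.
  by rewrite subn1 exprS /= mulr0 mulr0 addr0 [RHS]mulrCA mulKf.
have a1 : 0 <= r * (z - 1) by rewrite mulr_ge0 //; lra.
have tr0 : 0 <= t * r by rewrite mulr_ge0.
have a2 : t * (r * (z - 1)) <= 1 by nra.
have h1 := expr_add_le2 a1 a2; have h2 := expr_sub_le2 #|T| hr.
have zi0 : 0 <= z^-1 by rewrite invr_ge0; lra.
have zi1 : 0 <= 1 - z^-1 by rewrite subr_ge0 invf_le1 //; lra.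
apply: le_trans (lerD (ler_wpM2l zi0 h1) (ler_wpM2l zi1 h2)) _; rewrite -/t.
have -> : z^-1 * (1 + t * (r * (z - 1)) + (t * (r * (z - 1))) ^+ 2) +
   (1 - z^-1) * (1 - t * r + (t * r) ^+ 2) = 1 + (z - 1) * (t * r) ^+ 2 by field.
by have := sqr_ge0 (t * r); lra.
Qed.

(** Markov's inequality for [z ^+ excess f T] on the event of separation. *)
Lemma Pr_separated_excess p U T z : (forall i, 0 <= p i <= 1) -> U \subset T ->
  1 <= z -> (forall i, z * #|T|%:R * p i <= 1) ->
  Pr p (fun f => separated f U (~: T) && (#|T| <= (excess f T).+1)%N) <=
  (z ^+ (#|T| - 1))^-1 *
  expR (z * #|T|%:R ^+ 2 * \sum_i p i ^+ 2 - \sum_i contact (p i) #|U| #|~: T|).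
Proof.
move=> hp UT z1 zt; have z0 : 0 < z by lra.
have dU : [disjoint U & ~: T] by rewrite disjoints_subset setCK.
pose G (A : {set V}) : R :=
  ([disjoint A & U] || [disjoint A & ~: T])%:R * z ^+ (#|A :&: T| - 1).
apply: (@le_trans _ _ (Ex p (fun f => (z ^+ (#|T| - 1))^-1 * \prod_i G (f i)))).
  apply: Ex_le => // f.
  have Gge0 : 0 <= \prod_i G (f i).
    by apply: prodr_ge0 => i _; rewrite mulr_ge0 // exprn_ge0 // ltW.
  case: andP => [[sep ex]|_]; last by rewrite mulr_ge0 // invr_ge0 exprn_ge0 // ltW.
  rewrite /= mulrC ler_pdivlMr ?exprn_gt0 // mul1r /G big_split /=.
  rewrite prod_natb /= (_ : [forall _, _]) // mul1r prodrXr.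
  apply: ler_weXn2l => //; rewrite leq_subLR add1n; exact: ex.
rewrite ExZ; apply: ler_wpM2l; first by rewrite invr_ge0 exprn_ge0 // ltW.
rewrite (Ex_prod p (fun _ => G)) mulr_sumr -sumrB expR_sum.
apply: ler_prod => i _; apply/andP; split.
  by apply: sumr_ge0 => A _; rewrite mulr_ge0 ?vmass_ge0 // mulr_ge0 // exprn_ge0 // ltW.
apply: le_trans (expR_ge1Dx _).
have hx := vmass_excess (hp i) z1 (zt i).
have hs := vmass_separated (p i) dU.
(* An indicator $s$ and a weight $y \ge 1$ satisfy $s y \le s + (y - 1)$, so two separate
   expectations suffice although both depend on the same set. *)
apply: (@le_trans _ _ (\sum_A (vmass (p i) A * ([disjoint A & U] || [disjoint A & ~: T])%:R +
   (vmass (p i) A * z ^+ (#|A :&: T| - 1) - vmass (p i) A)))).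
  apply: ler_sum => A _; rewrite -[X in _ - X]mulr1 -mulrBr -mulrDr.
  rewrite ler_wpM2l ?vmass_ge0 // /G.
  have : 1 <= z ^+ (#|A :&: T| - 1) by rewrite exprn_ege1.
  by case: (_ || _) => /=; rewrite ?mul1r ?mul0r; lra.
rewrite big_split sumrB /= hs vmass_sum.
by move: hx; rewrite !exprMn; lra.
Qed.

Definition isolated f : pred V := fun v => [forall w, ~~ share f v w].

(** Turns a condition on pairs of vertices into a conjunction over the independent features. *)
Lemma isolated_setE f K : [forall v in K, isolated f v] =
  [forall i, [forall v in K, (v \in f i) ==> (f i == [set v])]].
Proof.
apply/idP/idP => [/forall_inP h|/forallP h].
  apply/forallP => i; apply/forall_inP => v vK; apply/implyP => vi.
  rewrite eqEsubset sub1set vi andbT; apply/subsetP => w wi; rewrite in_set1.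
  have /forallP/(_ w) := h v vK; rewrite /share negb_and negbK => /orP[/eqP->//|].
  by rewrite negb_exists => /forallP/(_ i); rewrite vi wi.
apply/forall_inP => v vK; apply/forallP => w; rewrite /share negb_and negbK.
case: eqVneq => //= nvw; rewrite negb_exists; apply/forallP => i.
apply/negP => /andP[vi wi]; have /forall_inP/(_ v vK) := h i.
by rewrite vi => /eqP e; move: wi; rewrite e in_set1 eq_sym (negbTE nvw).
Qed.

Lemma vmass_set1 r v : vmass r [set v] = r * (1 - r) ^+ #|V|.-1.
Proof.
rewrite /vmass (bigD1 v) //= in_set1 eqxx; congr (_ * _).
rewrite (eq_bigr (fun=> 1 - r)) => [|w /negbTE nwv]; last by rewrite in_set1 nwv.
by rewrite prodr_const; congr (_ ^+ _); rewrite -[#|V|]cardsT (cardsD1 v) in_setT;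
   apply: eq_card => w; rewrite !inE andbT.
Qed.

(** Probability that the vertex set of a feature of density [r] avoids [k] given vertices or
    consists of one of them alone. *)
Definition isofac r (k : nat) : R := (1 - r) ^+ k + k%:R * (r * (1 - r) ^+ #|V|.-1).

Lemma vmass_isolated r K :
  \sum_A vmass r A * [forall v in K, (v \in A) ==> (A == [set v])]%:R = isofac r #|K|.
Proof.
transitivity (\sum_A (vmass r A * [disjoint A & K]%:R +
                      \sum_(v in K) vmass r A * (A == [set v])%:R)).
  apply: eq_bigr => A _; rewrite -mulr_sumr -mulrDr; congr (_ * _).
  case: (boolP [disjoint A & K]) => [dA|].
    rewrite big1 ?addr0 => [|v vK]; last first.
      by case: eqP => // e; have := disjointFr dA (x := v); rewrite e in_set1 eqxx vK => /(_ isT).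
    rewrite (_ : [forall v in K, _]) //; apply/forall_inP => v vK.
    by apply/implyP => vA; have := disjointFr dA vA; rewrite vK.
  case/pred0Pn => v /andP[/= vA vK]; rewrite add0r (bigD1 v) //= [X in _ + X]big1 ?addr0.
    congr ((nat_of_bool _)%:R); apply/forall_inP/eqP => [/(_ v vK)|->]; first by rewrite vA => /eqP.
    by move=> w _; apply/implyP; rewrite in_set1 => /eqP->.
  move=> w /andP[wK nwv]; case: eqP => // e.
  by move: vA; rewrite e in_set1 eq_sym (negbTE nwv).
rewrite big_split /= vmass_disjoint exchange_big /=; congr (_ + _).
rewrite (eq_bigr (fun=> r * (1 - r) ^+ #|V|.-1)); last first.
  move=> v _; rewrite (bigD1 [set v]) //= eqxx mulr1 vmass_set1 big1 ?addr0 //.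
  by move=> A /negbTE->; rewrite mulr0.
by rewrite sumr_const mulr_natl.
Qed.

Definition isoprob p (k : nat) : R := \prod_i isofac (p i) k.

Lemma Pr_isolated p K : Pr p (fun f => [forall v in K, isolated f v]) = isoprob p #|K|.
Proof.
transitivity (Ex p (fun f =>
    \prod_i [forall v in K, (v \in f i) ==> (f i == [set v])]%:R)).
  by apply: eq_Ex => f; rewrite prod_natb -isolated_setE.
rewrite (Ex_prod p (fun _ A => [forall v in K, (v \in A) ==> (A == [set v])]%:R)).
by apply: eq_bigr => i _; apply: vmass_isolated.
Qed.

Definition isolated_set f : {set V} := finset (isolated f).

Lemma Ex_binomial_isolated p (k : nat) :
  Ex p (fun f => 'C(#|isolated_set f|, k)%:R) = 'C(#|V|, k)%:R * isoprob p k.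
Proof.
transitivity (Ex p (fun f => \sum_(K : {set V} | #|K| == k) [forall v in K, isolated f v]%:R)).
  apply: eq_Ex => f; rewrite -cards_draws -sum1_card natr_sum /= [RHS]big_mkcond /=.
  rewrite [LHS]big_mkcond; apply: eq_bigr => K _; rewrite inE.
  have -> : (K \subset isolated_set f) = [forall v in K, isolated f v].
    by apply/subsetP/forall_inP => h v /h; rewrite inE.
  by case: [forall _ in _, _]; case: (_ == k).
rewrite Ex_sum (eq_bigr (fun=> isoprob p k)) => [|K /eqP<-]; last exact: Pr_isolated.
rewrite sumr_const -card_draws mulr_natl; congr (_ *+ _).
by apply: eq_card => K; rewrite inE.
Qed.

End ProductSpace.

(** * Splitting, merging and deleting features *)

Section Transport.
Import mathcomp.boot.fintype mathcomp.boot.finset.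
Local Open Scope set_scope.
Local Open Scope ring_scope.
Variable R : realType.

(** The fibres of a coordinatewise map are products of fibres, so the image of a product measure is
    the product of the images. *)
Lemma sum_ffun_push (I T T' : finType) (M : I -> T -> R) (h : I -> T -> T')
    (g : {ffun I -> T'} -> R) :
  \sum_(f : {ffun I -> T}) (\prod_i M i (f i)) * g [ffun i => h i (f i)] =
  \sum_(f' : {ffun I -> T'}) (\prod_i \sum_(t | h i t == f' i) M i t) * g f'.
Proof.
rewrite (partition_big (fun f : {ffun I -> T} => [ffun i => h i (f i)]) xpredT) //=.
apply: eq_bigr => f' _; rewrite bigA_distr_big_dep mulr_suml.
apply: eq_big => [f|f /eqP<- //].
apply/eqP/familyP => [<- i|H]; first by rewrite unfold_in /= ffunE.
by apply/ffunP => i; rewrite ffunE; apply/eqP; apply: H.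
Qed.

Section Transpose.
Variables V I : finType.

Definition transpose (f : {ffun I -> {set V}}) : {ffun V -> {set I}} :=
  [ffun v => finset (fun i => v \in f i)].

Lemma in_transpose f v i : (i \in transpose f v) = (v \in f i).
Proof. by rewrite ffunE inE. Qed.

End Transpose.

Lemma transposeK (V I : finType) : cancel (@transpose V I) (@transpose I V).
Proof. by move=> f; apply/ffunP => i; apply/setP => v; rewrite !in_transpose. Qed.

Lemma transpose_bij (V I : finType) : bijective (@transpose V I).
Proof. by exists (@transpose I V); apply: transposeK. Qed.

Lemma rig_PrE (N m : nat) (p : 'I_m -> R) (E : pred (features N m)) :
  rig_Pr p E = Pr p (fun f : {ffun 'I_m -> {set 'I_N}} => E (transpose f)).
Proof.
rewrite /rig_Pr (reindex (@transpose 'I_N 'I_m)) /=; last first.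
  by apply: onW_bij; apply: transpose_bij.
rewrite /Pr /Ex big_mkcond; apply: eq_bigr => f _.
suff -> : rig_mass p (transpose f) = mass p f by case: (E _); rewrite ?mulr1 ?mulr0.
rewrite /rig_mass /mass exchange_big; apply: eq_bigr => i _.
by apply: eq_bigr => v _; rewrite in_transpose.
Qed.

Lemma rig_adj_transpose (N m : nat) (f : {ffun 'I_m -> {set 'I_N}}) :
  rig_adj (transpose f) =2 share f.
Proof.
move=> v w; rewrite /rig_adj /share; congr (_ && _).
apply/set0Pn/existsP => -[i]; first by rewrite in_setI !in_transpose => h; exists i.
by move=> h; exists i; rewrite in_setI !in_transpose.
Qed.

(** * Deleting features *)

Section Increasing.
Variables (V I : finType).

Lemma vmass0 (A : {set V}) : vmass (0 : R) A = (A == set0)%:R.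
Proof.
case: eqP => [->|/eqP/set0Pn[v vA]].
  by rewrite /vmass big1 // => v _; rewrite in_set0 subr0.
by rewrite /vmass (bigD1 v) //= vA mul0r.
Qed.

(** A coupling: emptying the features outside [S] gives them density [0] and only shrinks the
    family. *)
Lemma Pr_restrict (p : I -> R) (S : {set I}) (E : pred {ffun I -> {set V}}) :
  (forall i, 0 <= p i <= 1) ->
  (forall f g : {ffun I -> {set V}}, (forall i, f i \subset g i) -> E f -> E g) ->
  Pr (fun i => if i \in S then p i else 0) E <= Pr p E.
Proof.
move=> hp incr.
have -> : Pr (fun i => if i \in S then p i else 0) E =
  Ex p (fun f => (E [ffun i => if i \in S then f i else set0])%:R).
  rewrite /Ex (sum_ffun_push (fun i => vmass (p i)) (fun i A => if i \in S then A else set0)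
    (fun f => (E f)%:R)).
  apply: eq_bigr => f _; congr (_ * _); apply: eq_bigr => i _.
  case: ifP => _; first by rewrite big_pred1_eq.
  rewrite vmass0; case: eqP => [->|/eqP ne].
    rewrite (eq_bigl xpredT) ?vmass_sum // => A; exact: eqxx.
  by rewrite big_pred0 // => A; rewrite eq_sym; apply/negbTE.
apply: Ex_le => // f; rewrite ler_nat.
case: (boolP (E [ffun i => _])) => // /incr -> // i.
by rewrite ffunE; case: ifP => _; rewrite ?sub0set.
Qed.

End Increasing.

(** * Merging independent features *)

Section Merge.
Variables (V I J : finType).

Definition merge (f : {ffun I * J -> {set V}}) : {ffun I -> {set V}} :=
  [ffun i => \bigcup_j f (i, j)].

(** After transposition the sum runs over the independent sets of parts [j] held by the vertices,
    and a vertex lies in the union when its set is nonempty. *)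
Lemma vmass_bigcup (r : J -> R) (A : {set V}) :
  \sum_(b : {ffun J -> {set V}} | \bigcup_j b j == A) \prod_j vmass (r j) (b j) =
  vmass (1 - \prod_j (1 - r j)) A.
Proof.
rewrite (reindex (@transpose J V)) /=; last by apply: onW_bij; apply: transpose_bij.
pose w (B : {set J}) : R := \prod_j (if j \in B then r j else 1 - r j).
transitivity (\sum_(s in family (fun v (B : {set J}) => (B != set0) == (v \in A)))
   \prod_v w (s v)).
  apply: eq_big => [s|s _].
    apply/eqP/familyP => [<- v|h].
      rewrite unfold_in /=; apply/eqP; apply/set0Pn/bigcupP => -[j]; last first.
        by rewrite in_transpose; exists j.
      by move=> ?; exists j; rewrite ?in_transpose.
    apply/setP => v; have := h v; rewrite unfold_in /= => /eqP<-.
    apply/bigcupP/set0Pn => -[j]; first by rewrite in_transpose; exists j.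
    by move=> ?; exists j; rewrite ?in_transpose.
  rewrite /vmass /w exchange_big; apply: eq_bigr => v _.
  by apply: eq_bigr => j _; rewrite in_transpose.
rewrite -(bigA_distr_big_dep (fun v (B : {set J}) => (B != set0) == (v \in A)) (fun=> w)).
have tot : \sum_B w B = 1.
  by rewrite -bigA_distr big1 // => j _ /=; rewrite addrC subrK.
have w0 : w set0 = \prod_j (1 - r j) by apply: eq_bigr => j _; rewrite in_set0.
rewrite (bigD1 set0) //= w0 in tot.
apply: eq_bigr => v _; case: (v \in A).
  apply: (addrI (\prod_j (1 - r j))); rewrite [RHS]addrC subrK -[RHS]tot; congr (_ + _).
  by apply: eq_bigl => B; rewrite eqb_id.
rewrite opprB addrC subrK -w0 (eq_bigl (pred1 set0)) ?big_pred1_eq // => B.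
by rewrite eqbF_neg negbK.
Qed.

Lemma Ex_merge (r : I * J -> R) (p : I -> R) (g : {ffun I -> {set V}} -> R) :
  (forall i, \prod_j (1 - r (i, j)) = 1 - p i) ->
  Ex r (fun f => g (merge f)) = Ex p g.
Proof.
move=> hr; pose cur (F : {ffun I -> {ffun J -> {set V}}}) : {ffun I * J -> {set V}} :=
  [ffun x => F x.1 x.2].
pose unc (f : {ffun I * J -> {set V}}) : {ffun I -> {ffun J -> {set V}}} :=
  [ffun i => [ffun j => f (i, j)]].
rewrite /Ex (reindex cur) /=; last first.
  apply: onW_bij; exists unc => f.
    by apply/ffunP => i; apply/ffunP => j; rewrite !ffunE.
  by apply/ffunP => -[i j]; rewrite !ffunE.
pose M i (b : {ffun J -> {set V}}) := \prod_j vmass (r (i, j)) (b j).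
transitivity (\sum_(F : {ffun I -> {ffun J -> {set V}}})
    (\prod_i M i (F i)) * g [ffun i => \bigcup_j F i j]).
  apply: eq_bigr => F _; congr (_ * g _); last first.
    by apply/ffunP => i; rewrite !ffunE; apply: eq_bigr => j _; rewrite ffunE.
  rewrite /mass /M [RHS]pair_bigA; apply: eq_bigr => -[i j] _ /=.
  by rewrite ffunE.
rewrite (sum_ffun_push M (fun _ b => \bigcup_j b j)); apply: eq_bigr => f _.
congr (_ * _); apply: eq_bigr => i _.
by rewrite vmass_bigcup hr opprB addrC subrK.
Qed.

End Merge.

(** Probability that a given vertex shares a feature of density [r] with one of the other [N.-1]
    vertices; [N] times its sum over the features is [S1]. *)
Definition qprob (N : nat) (r : R) : R := r * (1 - (1 - r) ^+ N.-1).

Lemma qprob_ge0 N r : 0 <= r <= 1 -> 0 <= qprob N r.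
Proof. by case/andP=> r0 r1; rewrite mulr_ge0 // subr_ge0 exprn_ile1 //; lra. Qed.

Lemma qprob_le N r : 0 <= r <= 1 -> qprob N r <= r.
Proof.
case/andP=> r0 r1; rewrite -[leRHS]mulr1 ler_wpM2l // lerBlDr lerDl exprn_ge0 //; lra.
Qed.

Lemma exists_root (x : R) (k : nat) : 0 < x <= 1 -> (0 < k)%N ->
  exists2 r, 0 <= r <= 1 & (1 - r) ^+ k = x.
Proof.
case/andP=> x0 x1 k0; exists (1 - x `^ k%:R^-1).
  rewrite subr_ge0 lerBlDr lerDl powR_ge0 andbT.
  have e1 : 1 `^ k%:R^-1 = 1 :> R by rewrite powR1.
  rewrite -[leRHS]e1; apply: ge0_ler_powR; rewrite ?invr_ge0 ?nnegrE //.
  exact: ltW.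
by rewrite opprB addrC subrK -powR_mulrn ?powR_ge0 // -powRrM mulVf ?powRr1 ?ltW // pnatr_eq0 -lt0n.
Qed.

(* [k] is about [2 N p / B], so that [r] lies between [B / (4 N)] and [B / N]. *)
Lemma split_feature (N : nat) (B p : R) : (2 <= N)%N -> 1 <= B -> 0 < p <= 2^-1 ->
  exists k r, [/\ (0 < k)%N, 0 <= r <= 1, r <= B / N%:R, (1 - r) ^+ k = 1 - p &
    (1 - expR (- (B / 8))) * qprob N p <= k%:R * qprob N r].
Proof.
move=> N2 B1 /andP[p0 p1].
have N0 : 0 < N%:R :> R by rewrite ltr0n; lia.
have N2' : 2 <= N%:R :> R by rewrite ler_nat.
have hN : N%:R = N.-1%:R + 1 :> R by rewrite natr1 prednK // ltnW.
have hp : 0 <= p <= 1 by apply/andP; split; lra.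
have e0 := expR_gt0 (- (B / 8)).
have q0 := qprob_ge0 N hp.
have [NpB|NpB] := leP (N%:R * p) B.
  exists 1%N, p; split; rewrite ?expr1 ?mul1r //; first by rewrite ler_pdivlMr // mulrC.
  by rewrite ler_piMl // gerBl ltW.
set y := 2 * (N%:R * p) / B; have B0 : 0 < B by lra.
have y2 : 2 <= y by rewrite /y ler_pdivlMr //; lra.
set k := (Num.trunc y).+1.
have y0 : 0 <= y by lra.
have /andP[k1 k2] := truncn_itv y0.
have ky : y <= k%:R by apply: ltW.
have k3y : k%:R <= 2 * y by rewrite /k -natr1; lra.
have [r hr er] : exists2 r, 0 <= r <= 1 & (1 - r) ^+ k = 1 - p.
  by apply: exists_root => //; apply/andP; split; lra.
have [r0 r1] := andP hr.
have kr_ge : p <= k%:R * r by have := bernoulli_sub k hr; rewrite er; lra.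
(* Here [p <= 2^-1] enters: [(1 - p) * (1 + k r) <= 1] gives [k r <= p / (1 - p) <= 2 p]. *)
have kr_le : k%:R * r <= 2 * p.
  have := expr_sub_mul_le1 k hr; rewrite er => h.
  have : 0 <= k%:R * r by rewrite mulr_ge0.
  by nra.
have k0 : 0 < k%:R :> R by [].
have rB : r <= B / N%:R.
  rewrite ler_pdivlMr //.
  have : y * r <= 2 * p by apply: le_trans kr_le; rewrite ler_wpM2r.
  rewrite /y mulrAC ler_pdivrMr // => h.
  have : p * (2 * (r * N%:R)) <= p * (2 * B) by nra.
  by rewrite ler_pM2l //; lra.
have rB' : B / 4 <= r * N%:R.
  have : p <= 2 * y * r by apply: le_trans kr_ge _; rewrite ler_wpM2r.
  rewrite /y => h.
  have : p * B <= p * (4 * (r * N%:R)).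
    have := ler_wpM2r (ltW B0) h.
    have -> : 2 * (2 * (N%:R * p) / B) * r * B = p * (4 * (r * N%:R)) by field; rewrite gt_eqF.
    by [].
  by rewrite ler_pM2l //; lra.
exists k, r; split=> //.
(* The new density is still at least [B / (4 N)], so some other vertex shares the feature except
   with this probability, and [qprob N r] is nearly [r]. *)
have hexp : (1 - r) ^+ N.-1 <= expR (- (B / 8)).
  apply: (@le_trans _ _ (expR (- r) ^+ N.-1)).
    by apply: lerXn2r; rewrite ?nnegrE ?expR_ge0 ?subr_ge0 // expR_ge1Dx.
  rewrite -expRM_natl ler_expR mulrN lerN2.
  have : r <= r * N.-1%:R by rewrite ler_peMr // -(lerD2r 1) -hN.
  by move: rB'; rewrite hN; lra.
apply: (@le_trans _ _ ((1 - expR (- (B / 8))) * p)).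
  rewrite ler_wpM2l ?qprob_le //.
  by rewrite subr_ge0 -[leRHS]expR0 ler_expR; lra.
rewrite /qprob mulrA [leLHS]mulrC; apply: ler_pM; [exact: ltW| |exact: kr_ge|by lra].
by rewrite subr_ge0 -[leRHS]expR0 ler_expR; lra.
Qed.

(** To a subset of largest cardinality with sum at most [s] no further term, of size at most [e],
    can be added. *)
Lemma subset_sum (X : finType) (x : X -> R) (e s : R) :
  0 <= e -> (forall i, 0 <= x i <= e) -> 0 <= s <= \sum_i x i ->
  exists S : {set X}, s - e <= \sum_(i in S) x i <= s.
Proof.
move=> e0 hx /andP[s0 hs].
pose P (S : {set X}) := \sum_(i in S) x i <= s.
have P0 : P set0 by rewrite /P big_set0.
case: (arg_maxnP (fun S : {set X} => #|S|) P0) => S PS maxS.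
exists S; rewrite [X in _ && X]PS andbT leNgt; apply/negP => hlt.
have [i iS] : exists i, i \notin S.
  apply/existsP; rewrite -negb_forall; apply/negP => /forallP h.
  have hST : \sum_i x i = \sum_(i in S) x i by apply: eq_bigl => i; rewrite h.
  by move: hs hlt; rewrite hST; lra.
have H : P (i |: S) -> (#|i |: S| <= #|S|)%N by exact: maxS.
rewrite cardsU1 iS add1n ltnn in H; suff: false by [].
by apply: H; rewrite /P big_setU1 //=; have /andP[? ?] := hx i; lra.
Qed.

Lemma subdivide (I : finType) (N : nat) (B : R) (p : I -> R) :
  (2 <= N)%N -> 1 <= B -> (forall i, 0 < p i <= 2^-1) ->
  exists (K : nat) (r : I * 'I_K -> R),
  [/\ forall x, 0 <= r x <= 1, forall x, r x <= B / N%:R,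
      forall i, \prod_j (1 - r (i, j)) = 1 - p i &
      (1 - expR (- (B / 8))) * \sum_i qprob N (p i) <= \sum_x qprob N (r x)].
Proof.
move=> N2 B1 hp.
have H i : exists kr : nat * R, [/\ (0 < kr.1)%N, 0 <= kr.2 <= 1, kr.2 <= B / N%:R,
    (1 - kr.2) ^+ kr.1 = 1 - p i &
    (1 - expR (- (B / 8))) * qprob N (p i) <= kr.1%:R * qprob N kr.2].
  by have [k [r ?]] := split_feature N2 B1 (hp i); exists (k, r).
have [kr hkr] := choice H; pose K := (\max_i (kr i).1)%N.
have kK i : ((kr i).1 <= K)%N by apply: (leq_bigmax i).
(* Padding with density [0] gives every feature the same number [K] of parts; the padding has zero
   [qprob]. *)
exists K, (fun x : I * 'I_K => if (x.2 < (kr x.1).1)%N then (kr x.1).2 else 0).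
have cnt (x : R) i : \sum_(j < K | (j < (kr i).1)%N) x = (kr i).1%:R * x.
  by rewrite (big_ord_narrow (kK i)) sumr_const card_ord mulr_natl.
split=> [x|x|i|].
- by case: ifP => _; [have [] := hkr x.1|rewrite lexx ler01].
- by case: ifP => _; [have [] := hkr x.1|rewrite divr_ge0 //; lra].
- have [_ _ _ <- _] := hkr i.
  rewrite (eq_bigr (fun j : 'I_K => if (j < (kr i).1)%N then 1 - (kr i).2 else 1)).
    by rewrite -big_mkcond (big_ord_narrow (kK i)) prodr_const card_ord.
  by move=> j _ /=; case: ifP; rewrite ?subr0.
- rewrite -(pair_bigA _ (fun i (j : 'I_K) => qprob N (if (j < (kr i).1)%N then (kr i).2 else 0))).
  rewrite mulr_sumr; apply: ler_sum => i _; have [_ _ _ _ h] := hkr i.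
  apply: (le_trans h); rewrite -cnt big_mkcond; apply: ler_sum => j _.
  by case: ifP => _ //=; rewrite /qprob mul0r.
Qed.

Lemma thin_out (I : finType) (N : nat) (B s : R) (p : I -> R) :
  (2 <= N)%N -> 1 <= B <= N%:R -> (forall i, 0 < p i <= 2^-1) ->
  0 <= s <= (1 - expR (- (B / 8))) * \sum_i qprob N (p i) ->
  exists (I' : finType) (p' : I' -> R),
  [/\ forall i, 0 <= p' i <= B / N%:R,
      s - B / N%:R <= \sum_i qprob N (p' i) <= s &
      Pr p' (fun f : {ffun I' -> {set 'I_N}} => has_perfect_matching (share f)) <=
      Pr p (fun f : {ffun I -> {set 'I_N}} => has_perfect_matching (share f))].
Proof.
move=> N2 /andP[B1 BN] hp /andP[s0 hs].
have N0 : 0 < N%:R :> R by rewrite ltr0n; lia.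
have [K [r [r01 rB rp rq]]] := subdivide N2 B1 hp.
have e0 : 0 <= B / N%:R by rewrite divr_ge0 //; lra.
have [S hS] : exists S : {set I * 'I_K}, s - B / N%:R <= \sum_(x in S) qprob N (r x) <= s.
  apply: subset_sum => // [x|]; last by rewrite s0 (le_trans hs).
  by rewrite qprob_ge0 //= (le_trans (qprob_le _ _)).
exists (I * 'I_K)%type, (fun x => if x \in S then r x else 0); split.
- by move=> x; case: ifP => _; rewrite ?lexx // rB andbT; have /andP[] := r01 x.
- rewrite (eq_bigr (fun x => if x \in S then qprob N (r x) else 0)); first by rewrite -big_mkcond.
  by move=> x _; case: ifP => _ //; rewrite /qprob mul0r.
rewrite -[leRHS](Ex_merge (r := r)) //.
apply: (@le_trans _ _ (Pr r (fun f : {ffun I * 'I_K -> {set 'I_N}} =>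
    has_perfect_matching (share f)))).
  apply: Pr_restrict => // f g fg; apply: has_perfect_matching_mono => v w /andP[nvw /existsP[x /andP[vx wx]]].
  by apply/andP; split=> //; apply/existsP; exists x; rewrite !(subsetP (fg x)).
apply: Ex_le => // f; rewrite ler_nat.
suff : has_perfect_matching (share f) -> has_perfect_matching (share (merge f)).
  by case: (has_perfect_matching (share f)) => // ->.
apply: has_perfect_matching_mono => v w.
move=> /andP[nvw /existsP[[i j] /andP[vx wx]]]; apply/andP; split=> //.
by apply/existsP; exists i; rewrite !ffunE; apply/andP; split; apply/bigcupP; exists j.
Qed.

End Transport.

(** * Isolated vertices *)

Section Isolated.
Import mathcomp.boot.fintype mathcomp.boot.finset.
Local Open Scope ring_scope.
Variable R : realType.

(** For a positive count, truncated inclusion-exclusion has the sign of its last term or vanishes.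
    It thus bounds the indicator of a zero count from above for even [K] and from below for odd
    [K]. *)
Lemma bonferroni (x K : nat) :
  \sum_(k < K.+1) (-1) ^+ k * 'C(x.+1, k)%:R = (-1) ^+ K * 'C(x, K)%:R :> R.
Proof.
elim: K => [|K IH]; first by rewrite big_ord1 !bin0.
by rewrite big_ord_recr /= IH binS natrD exprS; ring.
Qed.

(** The main part of [isofac] is [1 - k qprob]; the remainder [(1 - r) ^+ k - 1 + k r] lies between
    [0] and [(k r) ^+ 2]. The lower bound then uses [1 - x >= expR (- x - 2 x ^+ 2)] for
    [x <= 2^-1]. *)
Lemma isofac_bounds (V : finType) (r : R) (k : nat) : 0 <= r <= 1 -> k%:R * r <= 2^-1 ->
  expR (- (k%:R * qprob #|V| r) - 2 * (k%:R * r) ^+ 2) <= isofac V r k <=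
  expR (- (k%:R * qprob #|V| r) + (k%:R * r) ^+ 2).
Proof.
move=> hr kr; have [r0 r1] := andP hr.
have e : 1 - k%:R * r + k%:R * (r * (1 - r) ^+ #|V|.-1) = 1 - k%:R * qprob #|V| r.
  by rewrite /qprob; ring.
have h1 := bernoulli_sub k hr; have h2 := expr_sub_le2 k hr.
have q0 : 0 <= k%:R * qprob #|V| r by rewrite mulr_ge0 ?qprob_ge0.
have qr : k%:R * qprob #|V| r <= k%:R * r by rewrite ler_wpM2l ?qprob_le.
rewrite /isofac; apply/andP; split; last first.
  by apply: le_trans (expR_ge1Dx _); lra.
set x := k%:R * qprob #|V| r in e q0 qr *.
apply: (@le_trans _ _ (1 - x)); last by lra.
apply: (@le_trans _ _ (expR (- (x + 2 * x ^+ 2)))).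
  rewrite ler_expR; have : x ^+ 2 <= (k%:R * r) ^+ 2 by rewrite lerXn2r ?nnegrE //; lra.
  by lra.
rewrite expRN -div1r ler_pdivrMr ?expR_gt0 //.
have h3 : (1 - x) * (1 + (x + 2 * x ^+ 2)) <= (1 - x) * expR (x + 2 * x ^+ 2).
  by rewrite ler_wpM2l ?expR_ge1Dx //; lra.
apply: le_trans h3.
have : 0 <= x ^+ 2 * (1 - 2 * x) by rewrite mulr_ge0 ?sqr_ge0 //; lra.
by lra.
Qed.

Lemma isoprob_bounds (V I : finType) (p : I -> R) (k : nat) :
  (forall i, 0 <= p i <= 1) -> (forall i, k%:R * p i <= 2^-1) ->
  expR (- (k%:R * \sum_i qprob #|V| (p i)) - 2 * (k%:R ^+ 2 * \sum_i p i ^+ 2)) <=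
    isoprob V p k <=
  expR (- (k%:R * \sum_i qprob #|V| (p i)) + k%:R ^+ 2 * \sum_i p i ^+ 2).
Proof.
move=> hp hk; set Q := \sum_i qprob _ _; set P2 := \sum_i _ ^+ 2.
have h i := andP (isofac_bounds V (hp i) (hk i)).
have -> : - (k%:R * Q) - 2 * (k%:R ^+ 2 * P2) =
   \sum_i (- (k%:R * qprob #|V| (p i)) - 2 * (k%:R * p i) ^+ 2).
  rewrite sumrB sumrN -!mulr_sumr; congr (_ - 2 * _).
  by rewrite mulr_sumr; apply: eq_bigr => i _; rewrite exprMn.
have -> : - (k%:R * Q) + (k%:R ^+ 2 * P2) =
   \sum_i (- (k%:R * qprob #|V| (p i)) + (k%:R * p i) ^+ 2).
  rewrite big_split sumrN -!mulr_sumr; congr (_ + _).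
  by rewrite mulr_sumr; apply: eq_bigr => i _; rewrite exprMn.
rewrite !expR_sum; apply/andP; split; apply: ler_prod => i _; have [h1 h2] := h i.
  by rewrite h1 expR_ge0.
by rewrite h2 (le_trans _ h1) ?expR_ge0.
Qed.

Definition no_isolated (V I : finType) : pred {ffun I -> {set V}} :=
  fun f => isolated_set f == set0.

Lemma no_isolatedE (V I : finType) (f : {ffun I -> {set V}}) :
  no_isolated f = (#|isolated_set f| == 0%N).
Proof. by rewrite cards_eq0. Qed.

Lemma no_isolatedP (V I : finType) (f : {ffun I -> {set V}}) :
  reflect (forall v, exists w, share f v w) (no_isolated f).
Proof.
apply: (iffP eqP) => [h v|h].
  have := in_set0 v; rewrite -h inE /isolated => /negbT; rewrite negb_forall.
  by case/existsP => w; rewrite negbK; exists w.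
apply/setP => v; rewrite in_set0 inE; apply/negbTE; rewrite negb_forall.
by have [w vw] := h v; apply/existsP; exists w; rewrite negbK.
Qed.

Lemma Pr_no_isolated_bonferroni (V I : finType) (p : I -> R) (j : nat) :
  (forall i, 0 <= p i <= 1) ->
  \sum_(k < j.*2) (-1) ^+ k * ('C(#|V|, k)%:R * isoprob V p k) <=
    Pr p (@no_isolated V I) <=
  \sum_(k < j.*2.+1) (-1) ^+ k * ('C(#|V|, k)%:R * isoprob V p k).
Proof.
move=> hp.
have E n : \sum_(k < n) (-1) ^+ k * ('C(#|V|, k)%:R * isoprob V p k) =
  Ex p (fun f => \sum_(k < n) (-1) ^+ k * 'C(#|@isolated_set V I f|, k)%:R).
  by rewrite Ex_sum; apply: eq_bigr => k _; rewrite ExZ Ex_binomial_isolated.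
have b0 n : \sum_(k < n.+1) (-1) ^+ k * 'C(0, k)%:R = 1 :> R.
  by rewrite big_ord_recl bin0 mulr1 big1 ?addr0 // => k _; rewrite bin0n /= mulr0.
rewrite !E; apply/andP; split; apply: Ex_le => // f; rewrite no_isolatedE.
  case: #|_| => [|x] /=; last first.
    case: j => [|j]; first by rewrite big_ord0.
    by rewrite doubleS bonferroni -signr_odd /= odd_double expr1 mulN1r oppr_le0.
  by case: j => [|j]; [rewrite big_ord0|rewrite doubleS b0].
case: #|_| => [|x] /=; first by rewrite b0.
by rewrite bonferroni -signr_odd odd_double mul1r.
Qed.

(** With [X] the number of isolated vertices and [mu] its mean, [mu ^+ 2] times the indicator of
    [X = 0] is at most [(X - mu) ^+ 2]. The first term bounds [1 / mu], the second bounds the excess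
    over [1] of the second factorial moment divided by [mu ^+ 2]. *)
Lemma Pr_no_isolated_chebyshev (V I : finType) (p : I -> R) :
  (0 < #|V|)%N -> (forall i, 0 <= p i <= 4^-1) ->
  Pr p (@no_isolated V I) <=
  expR (\sum_i qprob #|V| (p i) - ln #|V|%:R + 2 * \sum_i p i ^+ 2) +
  (expR (8 * \sum_i p i ^+ 2) - 1).
Proof.
move=> V0 hp4; set Q := \sum_i qprob _ _; set P2 := \sum_i _ ^+ 2.
have hp i : 0 <= p i <= 1 by have /andP[? ?] := hp4 i; apply/andP; split; lra.
have hk1 i : 1%:R * p i <= 2^-1 by have /andP[? ?] := hp4 i; lra.
have hk2 i : 2%:R * p i <= 2^-1 by have /andP[? ?] := hp4 i; lra.
have /andP[h1 _] := isoprob_bounds V hp hk1; rewrite -/Q -/P2 in h1.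
have /andP[_ h2] := isoprob_bounds V hp hk2; rewrite -/Q -/P2 in h2.
have N0 : 0 < #|V|%:R :> R by rewrite ltr0n.
set N : R := #|V|%:R in N0 *.
set A1 := isoprob V p 1 in h1 *; set A2 := isoprob V p 2 in h2 *.
have A10 : 0 < A1 by apply: lt_le_trans h1; apply: expR_gt0.
pose mu := N * A1; have mu0 : 0 < mu by rewrite mulr_gt0.
have hE : mu ^+ 2 * Pr p (@no_isolated V I) <=
    2 * ('C(#|V|, 2)%:R * A2) + (1 - 2 * mu) * ('C(#|V|, 1)%:R * A1) + mu ^+ 2.
  rewrite -!Ex_binomial_isolated -[X in _ + X](Ex_cst V p) -!ExZ -!ExD; apply: Ex_le => // f.
  rewrite no_isolatedE bin1; case: #|_| => [|x] /=; first by rewrite bin0n /= !mulr0 mulr1 !add0r.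
  rewrite mulr0.
  have -> : 2 * 'C(x.+1, 2)%:R = x.+1%:R * x%:R :> R.
    by rewrite -!natrM; congr (_%:R); rewrite mul2n bin2 -[RHS]even_halfK ?oddM //= ?andNb.
  have -> : x.+1%:R * x%:R + (1 - 2 * mu) * x.+1%:R + mu ^+ 2 = (x.+1%:R - mu) ^+ 2 :> R.
    by rewrite -natr1; ring.
  exact: sqr_ge0.
have bin2N : 2 * 'C(#|V|, 2)%:R <= N ^+ 2.
  rewrite -natrM -natrX ler_nat mul2n bin2.
  by have := half_leq; have := odd_double_half (#|V| * #|V|.-1); nia.
have A20 : 0 <= A2 by apply: prodr_ge0 => i _; have /andP[? ?] := hp i;
  rewrite addr_ge0 ?mulr_ge0 ?exprn_ge0 //; lra.
have hA : A2 <= A1 ^+ 2 * expR (8 * P2).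
  apply: (le_trans h2).
  apply: (@le_trans _ _ (expR (- (1%:R * Q) - 2 * (1%:R ^+ 2 * P2)) ^+ 2 * expR (8 * P2))).
    by rewrite -expRM_natl -expRD ler_expR; lra.
  by rewrite ler_wpM2r ?expR_ge0 // lerXn2r ?nnegrE ?expR_ge0 // ltW.
have hmu : mu^-1 <= expR (Q - ln N + 2 * P2).
  rewrite -[leRHS]invrK lef_pV2 ?posrE ?invr_gt0 ?expR_gt0 // -expRN.
  have -> : - (Q - ln N + 2 * P2) = ln N + (- (1%:R * Q) - 2 * (1%:R ^+ 2 * P2)) by ring.
  by rewrite expRD lnK ?posrE // /mu; apply: ler_wpM2l; first exact: ltW.
rewrite -(ler_pM2l (exprn_gt0 2 mu0)); apply: (le_trans hE); rewrite bin1 -/N -/mu.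
have e1 : mu <= mu ^+ 2 * expR (Q - ln N + 2 * P2).
  have := ler_wpM2l (exprn_ge0 2 (ltW mu0)) hmu.
  by rewrite expr2 -mulrA divff ?mulr1 // gt_eqF.
have e2 : 2 * ('C(#|V|, 2)%:R * A2) <= mu ^+ 2 * expR (8 * P2).
  rewrite mulrA; apply: (@le_trans _ _ (N ^+ 2 * A2)); first by rewrite ler_wpM2r.
  rewrite /mu exprMn -[leRHS]mulrA; apply: ler_wpM2l => //; exact: exprn_ge0 (ltW N0).
by lra.
Qed.

(** A single [d] bounds all errors, so that limits can be uniform over [I] and [p]: both change with
    [N] once features are split. *)
Definition near_threshold (N : nat) (I : finType) (p : I -> R) (a d : R) :=
  [/\ forall i, 0 <= p i <= d, \sum_i p i ^+ 2 <= d &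
      `|\sum_i qprob N (p i) - ln N%:R - a| <= d].

Local Open Scope classical_set_scope.

Lemma bin_div_expn_cvg (k : nat) :
  ('C(n, k)%:R / n%:R ^+ k : R) @[n --> \oo] --> (k`!%:R^-1 : R).
Proof.
have ff : ((n ^_ k)%:R / n%:R ^+ k : R) @[n --> \oo] --> (1 : R).
  elim: k => [|k IH].
    by under eq_fun do rewrite ffactn0 expr0 divr1; apply: cvg_cst.
  have h : ((n - k)%:R / n%:R : R) @[n --> \oo] --> (1 : R).
    have h1 : (1 - k%:R / n%:R : R) @[n --> \oo] --> (1 - k%:R * 0 : R).
      apply: cvgB; first exact: cvg_cst.
      apply: cvgM; first exact: cvg_cst.
      by rewrite -cvg_shiftS; exact: cvg_harmonic.
    rewrite mulr0 subr0 in h1; apply: cvg_trans h1; apply: near_eq_cvg; near=> n.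
    rewrite natrB; last by near: n; exact: nbhs_infty_ge.
    rewrite mulrBl divff // pnatr_eq0 -lt0n; near: n; exact: nbhs_infty_gt.
  have h2 : ((n ^_ k)%:R / n%:R ^+ k * ((n - k)%:R / n%:R) : R) @[n --> \oo] --> (1 * 1 : R).
    exact: cvgM IH h.
  rewrite mulr1 in h2.
  apply: cvg_trans h2; apply: near_eq_cvg; near=> n.
  by rewrite ffactnSr natrM exprSr invfM mulrACA.
have h3 : ((n ^_ k)%:R / n%:R ^+ k / k`!%:R : R) @[n --> \oo] --> (1 / k`!%:R : R).
  by apply: cvgM ff _; apply: cvg_cst.
rewrite mul1r in h3; apply: cvg_trans h3; apply: near_eq_cvg; near=> n.
by rewrite -bin_ffact natrM mulrAC mulfK // pnatr_eq0 -lt0n fact_gt0.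
Unshelve. all: by end_near. Qed.

Lemma distr_sandwich (l lo hi x e e' : R) : `|l - lo| <= e -> `|l - hi| <= e ->
  lo - e' <= x -> x <= hi + e' -> `|x - l| <= e + e'.
Proof.
by rewrite !ler_norml => /andP[? ?] /andP[? ?] ? ?; apply/andP; split; lra.
Qed.

Lemma near_forall_lt (P : nat -> nat -> Prop) (n : nat) :
  (forall k, \forall N \near \oo, P k N) ->
  \forall N \near \oo, forall k, (k < n)%N -> P k N.
Proof.
move=> h; elim: n => [|n IH]; first by near=> N.
near=> N => k; rewrite ltnS leq_eqVlt => /orP[/eqP->|kn]; first by near: N; exact: h.
have H : forall k, (k < n)%N -> P k N by near: N; exact: IH.
exact: H.
Unshelve. all: by end_near. Qed.

Lemma binomial_isoprob_cvg (d : nat -> R) (a e : R) (k : nat) :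
  d @ \oo --> (0 : R) -> 0 < e ->
  \forall N \near \oo, forall (I : finType) (p : I -> R), near_threshold N p a (d N) ->
    `|'C(N, k)%:R * isoprob 'I_N p k - expR (- a) ^+ k / k`!%:R| <= e.
Proof.
move=> d0 e0.
(* Common shape of the lower and upper bounds: all deviations go into [c * d N], and [N ^+ k] comes
   from [ln N] in the exponent. *)
pose g (c : R) (N : nat) : R := 'C(N, k)%:R / N%:R ^+ k * (expR (- a) ^+ k * expR (c * d N)).
have gc c : g c N @[N --> \oo] --> (expR (- a) ^+ k / k`!%:R : R).
  have h : g c N @[N --> \oo] --> (k`!%:R^-1 * (expR (- a) ^+ k * expR (c * 0)) : R).
    apply: cvgM; first exact: bin_div_expn_cvg.
    apply: cvgM; first exact: cvg_cst.
    apply: continuous_cvg; first exact: continuous_expR.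
    by apply: cvgM; [exact: cvg_cst|exact: d0].
  by rewrite mulr0 expR0 mulr1 mulrC in h.
have near_g c : \forall N \near \oo, `|expR (- a) ^+ k / k`!%:R - g c N| <= e.
  by have /cvgrPdist_le := gc c; apply.
near=> N => I p [hp hp2 hQ].
have N0 : 0 < N%:R :> R by rewrite ltr0n; near: N; exact: nbhs_infty_gt.
have dN : `|0 - d N| <= (2 * k%:R + 2)^-1.
  by near: N; move/cvgrPdist_le : d0; apply; rewrite invr_gt0 ltr_wpDl // mulr_ge0.
rewrite sub0r normrN in dN.
have k0 : 0 <= k%:R :> R by [].
have kd : k%:R * d N <= 2^-1 /\ d N <= 2^-1.
  have dN' : d N <= (2 * k%:R + 2)^-1 by apply: le_trans dN; apply: ler_norm.
  have h : d N * (2 * k%:R + 2) <= 1 by rewrite -ler_pdivlMr ?div1r //; lra.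
  split; last by rewrite (le_trans dN') // lef_pV2 ?posrE //; lra.
  have [d0'|d0'] := leP 0 (d N); first by lra.
  by have : k%:R * d N <= 0 by [rewrite mulr_ge0_le0 // ltW]; lra.
have hp1 i : 0 <= p i <= 1 by have /andP[? ?] := hp i; apply/andP; split; lra.
have hpk i : k%:R * p i <= 2^-1.
  have /andP[? h] := hp i; apply: le_trans kd.1; exact: ler_wpM2l.
have := isoprob_bounds 'I_N hp1 hpk; rewrite card_ord.
set Q := \sum_i qprob _ _ in hQ *; set P2 := \sum_i p i ^+ 2 in hp2 *.
have hN x : expR (- (k%:R * (ln N%:R + a)) + x) = expR (- a) ^+ k * expR x / N%:R ^+ k.
  have -> : - (k%:R * (ln N%:R + a)) + x = k%:R * (- ln N%:R) + (k%:R * (- a) + x) by ring.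
  by rewrite expRD expRM_natl expRN lnK ?posrE // exprVn expRD expRM_natl mulrC.
have C0 : 0 <= 'C(N, k)%:R :> R by [].
have P20 : 0 <= P2 by apply: sumr_ge0 => i _; apply: sqr_ge0.
have dN0 : 0 <= d N by apply: le_trans P20 hp2.
move: hQ; rewrite ler_norml => /andP[hQ1 hQ2].
have kQ1 : k%:R * (- d N) <= k%:R * (Q - ln N%:R - a) by rewrite ler_wpM2l.
have kQ2 : k%:R * (Q - ln N%:R - a) <= k%:R * d N by rewrite ler_wpM2l.
have kP : k%:R ^+ 2 * P2 <= k%:R ^+ 2 * d N by rewrite ler_wpM2l ?sqr_ge0.
case/andP => lo hi.
have glo : g (- (k%:R + 2 * k%:R ^+ 2)) N <= 'C(N, k)%:R * isoprob 'I_N p k.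
  rewrite /g -mulrA ler_wpM2l // mulrC -hN; apply: le_trans lo; rewrite ler_expR; lra.
have ghi : 'C(N, k)%:R * isoprob 'I_N p k <= g (k%:R + k%:R ^+ 2) N.
  rewrite /g -[leRHS]mulrA ler_wpM2l // [leRHS]mulrC -hN; apply: (le_trans hi).
  rewrite ler_expR; lra.
have h1 : `|expR (- a) ^+ k / k`!%:R - g (- (k%:R + 2 * k%:R ^+ 2)) N| <= e.
  by near: N; apply: near_g.
have h2 : `|expR (- a) ^+ k / k`!%:R - g (k%:R + k%:R ^+ 2) N| <= e.
  by near: N; apply: near_g.
rewrite -[e]addr0; apply: (distr_sandwich h1 h2); first by rewrite subr0.
by rewrite addr0.
Unshelve. all: by end_near. Qed.

Lemma Pr_no_isolated_cvg (d : nat -> R) (a e : R) :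
  d @ \oo --> (0 : R) -> 0 < e ->
  \forall N \near \oo, forall (I : finType) (p : I -> R), near_threshold N p a (d N) ->
    `|Pr p (@no_isolated 'I_N I) - expR (- expR (- a))| <= e.
Proof.
move=> d0 e0; set l := expR (- a).
(* One [j] serves both sides, since the truncations [j.*2] and [j.*2.+1] of the Bonferroni bounds
   both lie beyond it. *)
have [j _ hj] : \forall n \near \oo, `|expR (- l) - series (exp_coeff (- l)) n| <= e / 2.
  have /cvgrPdist_le : series (exp_coeff (- l)) @ \oo --> expR (- l).
    exact: (is_cvg_series_exp_coeff (- l)).
  by apply; rewrite divr_gt0.
have e'0 : 0 < e / 2 / (j.*2.+1)%:R by rewrite !divr_gt0.
have hall := near_forall_lt j.*2.+1 (fun k => binomial_isoprob_cvg a k d0 e'0).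
have d1 : \forall N \near \oo, d N <= 1.
  have /cvgrPdist_le/(_ 1 ltr01) := d0.
  apply: filterS => N; rewrite sub0r normrN => h; apply: le_trans h; exact: ler_norm.
near=> N => I p hp.
have H k : (k < j.*2.+1)%N ->
    `|'C(N, k)%:R * isoprob 'I_N p k - l ^+ k / k`!%:R| <= e / 2 / (j.*2.+1)%:R.
  move=> kj; move: k kj I p hp; near: N; apply: filterS hall => N h k kj I p hp.
  exact: h.
have hp1 i : 0 <= p i <= 1.
  have [/(_ i)/andP[h1 h2] _ _] := hp; rewrite h1 (le_trans h2) //; near: N; exact: d1.
have close n : (n <= j.*2.+1)%N ->
  `|\sum_(k < n) (-1) ^+ k * ('C(N, k)%:R * isoprob 'I_N p k) -
    series (exp_coeff (- l)) n| <= e / 2.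
  move=> nj; rewrite /series /= big_mkord -sumrB.
  apply: (le_trans (ler_norm_sum _ _ _)).
  apply: (@le_trans _ _ (\sum_(k < n) e / 2 / (j.*2.+1)%:R)).
    apply: ler_sum => k _; have hk := H k (leq_trans (ltn_ord k) nj).
    rewrite exp_coeffE /= (exprNn l) [X in _ - X]mulrCA -mulrBr normrM normrX normrN1 expr1n mul1r.
    by rewrite [_^-1 * _]mulrC.
  rewrite sumr_const card_ord -[leLHS]mulr_natr -[leLHS]mulrA.
  apply: ler_piMr; first by rewrite divr_ge0 // ltW.
  by rewrite mulrC ler_pdivrMr // mul1r ler_nat.
have /andP[lo hi] := Pr_no_isolated_bonferroni 'I_N j hp1.
rewrite card_ord in lo hi.
have c1 := close j.*2 (leqnSn _); have c2 := close j.*2.+1 (leqnn _).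
have s1 : `|expR (- l) - series (exp_coeff (- l)) j.*2| <= e / 2.
  by apply: hj; rewrite /= -addnn leq_addr.
have s2 : `|expR (- l) - series (exp_coeff (- l)) j.*2.+1| <= e / 2.
  by apply: hj; rewrite /= -addnn leqW // leq_addr.
have -> : e = e / 2 + e / 2 by rewrite -splitr.
apply: (distr_sandwich s1 s2).
  by apply: le_trans lo; rewrite lerBlDl -lerBlDr; move: c1; rewrite ler_norml lerNl opprB => /andP[].
by apply: (le_trans hi); rewrite -lerBlDl; move: c2; rewrite ler_norml => /andP[].
Unshelve. all: by end_near. Qed.

End Isolated.

(** * Union bounds *)

Section BadEvents.
Import mathcomp.boot.fintype mathcomp.boot.finset.
Local Open Scope ring_scope.
Variable R : realType.

(** [qprob N p] is comparable to [p] when [N p] is large and to [N p ^+ 2] when it is small; in both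
    cases [p ^+ 2] is at most [1 / (N - 1) + p] times it. *)
Lemma sum_sqr_le (I : finType) (N : nat) (p : I -> R) (b : R) :
  (forall i, 0 <= p i <= 1) -> (forall i, p i <= b) ->
  N.-1%:R * \sum_i p i ^+ 2 <= (1 + N.-1%:R * b) * \sum_i qprob N (p i).
Proof.
move=> hp hb; rewrite !mulr_sumr; apply: ler_sum => i _.
have /andP[p0 p1] := hp i; have h := one_sub_expr_ge N.-1 (hp i).
have q0 := qprob_ge0 N (hp i).
have n0 : 0 <= N.-1%:R :> R by [].
apply: (@le_trans _ _ ((1 + N.-1%:R * p i) * qprob N (p i))).
  have := ler_wpM2l p0 h; rewrite /qprob expr2; lra.
by rewrite ler_wpM2r // lerD2l ler_wpM2l.
Qed.

(** Holds for all set sizes at the price of a factor of order [B]: by concavity [1 - (1 - r) ^+ x]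
    is at least [x / N] times its value at [N], which is at least [N r / (2 B)]. *)
Lemma contact_ge (N x y : nat) (r B : R) : 1 <= B -> 0 <= r <= 1 -> N%:R * r <= B ->
  (x <= N)%N -> (y <= N)%N ->
  x%:R * y%:R * qprob N r <= 2 * B * N%:R * contact r x y.
Proof.
move=> B1 hr NrB xN yN; have [r0 r1] := andP hr.
have hr' : 0 <= 1 - r <= 1 by apply/andP; split; lra.
have hx := one_sub_expr_concave hr' xN; have hy := one_sub_expr_concave hr' yN.
have hN := one_sub_expr_ge N hr.
rewrite /contact /qprob.
have a0 : 0 <= 1 - (1 - r) ^+ N by rewrite subr_ge0 exprn_ile1 //; lra.
have x0 : 0 <= 1 - (1 - r) ^+ x by rewrite subr_ge0 exprn_ile1 //; lra.
have y0 : 0 <= 1 - (1 - r) ^+ y by rewrite subr_ge0 exprn_ile1 //; lra.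
have m0 : 0 <= 1 - (1 - r) ^+ N.-1 by rewrite subr_ge0 exprn_ile1 //; lra.
have hm : 1 - (1 - r) ^+ N.-1 <= 1 - (1 - r) ^+ N.
  by rewrite lerD2l lerN2; apply: ler_wiXn2l; rewrite ?leq_pred //; lra.
set A := 1 - (1 - r) ^+ N in hN a0 hm hx hy *; set X := 1 - (1 - r) ^+ x in hx x0 *.
set Y := 1 - (1 - r) ^+ y in hy y0 *; set M := 1 - (1 - r) ^+ N.-1 in m0 hm *.
case: (posnP N) => [N0|N0]; first by move: xN; rewrite N0 leqn0 => /eqP ->; rewrite !mul0r mulr0 mul0r.
have N0' : 0 < N%:R :> R by rewrite ltr0n.
have h1 : x%:R * r <= 2 * B * X.
  have e1 : N%:R * r <= 2 * B * A.
    have : A * (N%:R * r) <= A * B by rewrite ler_wpM2l.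
    by nra.
  rewrite -(ler_pM2l N0').
  have e2 := ler_wpM2l (ler0n R x) e1.
  have e3 : 2 * B * (x%:R * A) <= 2 * B * (N%:R * X) by rewrite ler_wpM2l //; lra.
  by lra.
have h2 : y%:R * M <= N%:R * Y by apply: le_trans hy; rewrite ler_wpM2l.
have -> : x%:R * y%:R * (r * M) = (x%:R * r) * (y%:R * M) by ring.
have -> : 2 * B * N%:R * (X * Y) = (2 * B * X) * (N%:R * Y) by ring.
by apply: ler_pM => //; rewrite mulr_ge0.
Qed.

(** For small sets no factor [B] may be lost, as this has to outweigh a factor [N] of the union
    bound. The constant [11 / 12] is just below [(23 / 24) ^+ 2], one factor per set. *)
Lemma contact_ge_sharp (N x y : nat) (r : R) : 0 <= r <= 1 -> x%:R * r <= 24^-1 ->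
  (y < N)%N -> (24 * (N - y) <= N)%N ->
  11 / 12 * (x%:R * qprob N r) <= contact r x y.
Proof.
move=> hr xr yN hy24; have [r0 r1] := andP hr.
have hr' : 0 <= 1 - r <= 1 by apply/andP; split; lra.
have yN1 : (y <= N.-1)%N by lia.
have h23 : (23 * N.-1 <= 24 * y)%N by lia.
have hy := one_sub_expr_concave hr' yN1.
have h2 := expr_sub_le2 x hr.
have x0 : 0 <= x%:R * r by rewrite mulr_ge0.
have hX : 23 / 24 * (x%:R * r) <= 1 - (1 - r) ^+ x.
  have : (x%:R * r) ^+ 2 <= 24^-1 * (x%:R * r) by rewrite expr2 ler_wpM2r.
  by lra.
rewrite /contact /qprob.
have m0 : 0 <= 1 - (1 - r) ^+ N.-1 by rewrite subr_ge0 exprn_ile1 //; lra.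
set X := 1 - _ ^+ x in hX *; set Y := 1 - _ ^+ y in hy *; set M := 1 - _ ^+ N.-1 in hy m0 *.
have hY : 23 / 24 * M <= Y.
  case: (posnP N.-1) => [n0|n0].
    have -> : M = 0 by rewrite /M n0 expr0 subrr.
    rewrite mulr0 /Y subr_ge0 exprn_ile1 //; lra.
  have n0' : 0 < N.-1%:R :> R by rewrite ltr0n.
  rewrite -(ler_pM2l n0'); apply: le_trans hy.
  rewrite mulrCA [leLHS]mulrA ler_wpM2r //.
  by move: h23; rewrite -(ler_nat R) !natrM; lra.
apply: (@le_trans _ _ ((23 / 24 * (x%:R * r)) * (23 / 24 * M))).
  have : 0 <= x%:R * r * M by rewrite mulr_ge0.
  by lra.
by apply: ler_pM => //; rewrite mulr_ge0 //; lra.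
Qed.

Lemma bin_mul_expn_le (N t : nat) :
  'C(N, t)%:R * t%:R ^+ t <= N%:R ^+ t * expR t%:R :> R.
Proof.
have ht : t%:R ^+ t <= t`!%:R * expR t%:R :> R.
  case: t => [|n]; first by rewrite expr0 fact0 mul1r expR0.
  have := @expR_ge1Dxn R n.+1%:R n (ler0n R _).
  have f0 : 0 < (n.+1)`!%:R :> R by rewrite ltr0n fact_gt0.
  move=> h; rewrite mulrC -ler_pdivrMr //; lra.
apply: (@le_trans _ _ ('C(N, t)%:R * (t`!%:R * expR t%:R))); first by rewrite ler_wpM2l.
rewrite mulrA -natrM bin_ffact; apply: ler_wpM2r; first exact: expR_ge0.
rewrite -natrX ler_nat.
elim: t {ht} => [|t IH]; first by rewrite ffactn0 expn0.
by rewrite ffactnSr expnSr leq_mul // leq_subr.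
Qed.

Lemma sum_set_card (V : finType) (g : nat -> R) :
  \sum_(T : {set V}) g #|T| = \sum_(t < #|V|.+1) 'C(#|V|, t)%:R * g t.
Proof.
pose c (T : {set V}) : 'I_#|V|.+1 := inord #|T|.
have cE T : c T = #|T| :> nat by rewrite inordK // ltnS max_card.
rewrite (partition_big c xpredT) //=; apply: eq_bigr => t _.
rewrite (eq_bigr (fun=> g t)) => [|T /eqP<-]; last by rewrite cE.
rewrite sumr_const mulr_natl -card_draws; congr (_ *+ _).
by apply: eq_card => T; rewrite [RHS]inE [LHS]unfold_in /= cE.
Qed.

Lemma sum_half_pow (n : nat) : \sum_(t < n) (2^-1 : R) ^+ t <= 2.
Proof.
suff : \sum_(t < n) (2^-1 : R) ^+ t = 2 - 2 * 2^-1 ^+ n.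
  by move=> ->; rewrite lerBlDr lerDl mulr_ge0 // exprn_ge0 // invr_ge0.
elim: n => [|n IH]; first by rewrite big_ord0 expr0; lra.
by rewrite big_ord_recr /= IH exprS; lra.
Qed.

Section Bounds.
Variables (N : nat) (I : finType) (p : I -> R) (B : R).
Let Q := \sum_i qprob N (p i).

(** Half of [10 / 11] times the [11 / 12] of [contact_ge_sharp] is [5 / 12]; for [|T| >= 2] the
    resulting [5 / 12 * (|T| + 1)] exceeds [1], the exponent of [N = expR (B ^+ 2)]. *)
Definition dense_regime := [/\ (56 <= N)%N, 24 <= B <= N%:R, ln N%:R = B ^+ 2,
  forall i, 0 <= p i <= B / N%:R & 10 / 11 * B ^+ 2 <= Q <= 2 * B ^+ 2].

Lemma dense_regime_bounds : dense_regime ->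
  [/\ 0 < N%:R :> R, forall i, 0 <= p i <= 1 & forall i, N%:R * p i <= B].
Proof.
case=> N0 /andP[hB hpB] _ hp _.
have NR0 : 0 < N%:R :> R by rewrite ltr0n; lia.
split=> // i; have /andP[p0 h1] := hp i; last by rewrite mulrC -ler_pdivlMr.
by rewrite p0 (le_trans h1) // ler_pdivrMr // mul1r.
Qed.

Lemma sum_contact_ge (x y : nat) : dense_regime -> (x <= N)%N -> (y <= N)%N ->
  x%:R * y%:R * Q <= 2 * B * N%:R * \sum_i contact (p i) x y.
Proof.
move=> H xN yN; have [N0 /andP[hB _] _ _ _] := H.
have [NR0 hp1 hNp] := dense_regime_bounds H.
rewrite !mulr_sumr; apply: ler_sum => i _; have B1 : 1 <= B by lra.
exact: contact_ge B1 (hp1 i) (hNp i) xN yN.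
Qed.

Definition bad_pair (f : {ffun I -> {set 'I_N}}) (U T : {set 'I_N}) :=
  separated f U (~: T) && (#|T| <= (excess f T).+1)%N.

(** The Markov factor cancels the binomial coefficient up to one factor [N] and powers of [B ^+ 3],
    which separation pays for. Per vertex of [T], [expR 10] collects [e] from the binomial
    coefficient, [e >= 2] from the choice of [U] and [expR 8] from the exponential moment. *)
Lemma Pr_bad_pair_small (U T : {set 'I_N}) : dense_regime ->
  U \subset T -> (#|T| < 2 * #|U|)%N -> (1 < #|U|)%N -> #|T|%:R * B ^+ 3 <= N%:R ->
  'C(N, #|T|)%:R * 2 ^+ #|T| * Pr p (fun f => bad_pair f U T) <=
  expR (7 / 12 * B ^+ 2) * (expR 10 * B ^+ 3 * expR (- (5 / 12 * B ^+ 2))) ^+ #|T|.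
Proof.
move=> H UT T2U U2 tB; have [N0 /andP[hB hpB] LB hp hQ] := H.
have [NR0 hp1 hNp] := dense_regime_bounds H.
set t := #|T| in T2U tB *; set u := #|U| in T2U U2 *.
have ut : (u <= t)%N by apply: subset_leq_card.
have t0 : (0 < t)%N by apply: leq_trans ut; apply: ltnW.
have tN : (t <= N)%N by rewrite -[leqRHS]card_ord max_card.
have Npos : (0 < N)%N by apply: leq_trans N0.
have tR : 1 <= t%:R :> R by rewrite ler1n.
have B3 : 24 ^+ 3 <= B ^+ 3 by rewrite lerXn2r ?nnegrE //; lra.
have B30 : 0 < B ^+ 3 by lra.
have B2 : 24 ^+ 2 <= B ^+ 2 by rewrite lerXn2r ?nnegrE //; lra.
have tB0 : 0 < t%:R * B ^+ 3 by rewrite mulr_gt0 //; lra.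
(* The power [B ^+ 3] keeps the exponential moment harmless: [N * \sum_i p i ^+ 2 <= 4 * B * Q <= 8
   * B ^+ 3], so the exponent is at most [8 * t]. *)
pose z := N%:R / (t%:R * B ^+ 3).
have z1 : 1 <= z by rewrite ler_pdivlMr // mul1r.
have z0 : 0 < z by lra.
have ztp i : z * t%:R * p i <= 1.
  have -> : z * t%:R * p i = (N%:R * p i) / B ^+ 3.
    by rewrite /z; field; rewrite !gt_eqF //; lra.
  rewrite ler_pdivrMr // mul1r; apply: (le_trans (hNp i)).
  rewrite exprS ler_peMr //; lra.
have hPr := Pr_separated_excess hp1 UT z1 ztp.
have cT : #|~: T| = (N - t)%N by rewrite -[LHS](addKn t) cardsC card_ord.
rewrite cT -/t -/u in hPr.
have t24 : (24 * t <= N)%N.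
  rewrite -(ler_nat R) natrM; apply: le_trans tB.
  by rewrite mulrC ler_wpM2l //; lra.
have hcon : 11 / 12 * (u%:R * Q) <= \sum_i contact (p i) u (N - t)%N.
  rewrite !mulr_sumr; apply: ler_sum => i _; apply: contact_ge_sharp => //.
  2: by rewrite ltn_subrL t0 Npos.
  2: by rewrite subKn.
  have /andP[p0 _] := hp i.
  apply: (@le_trans _ _ (t%:R * p i)); first by rewrite ler_wpM2r // ler_nat.
  rewrite -(ler_pM2r B30).
  have h1 : t%:R * p i * B ^+ 3 <= N%:R * p i.
    by rewrite mulrAC ler_wpM2r.
  apply: (le_trans h1); apply: (le_trans (hNp i)).
  rewrite exprS mulrCA ler_peMr //; lra.
have hsq : z * t%:R ^+ 2 * \sum_i p i ^+ 2 <= 8 * t%:R.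
  have h1 := sum_sqr_le N hp1 (fun i => proj2 (andP (hp i))).
  rewrite -/Q in h1; set P2 := \sum_i _ ^+ 2 in h1 *.
  have P20 : 0 <= P2 by apply: sumr_ge0 => i _; apply: sqr_ge0.
  have n1 : N%:R = N.-1%:R + 1 :> R by rewrite natr1 prednK.
  have n2 : 56 <= N%:R :> R by rewrite (ler_nat R 56).
  have BN0 : 0 <= B / N%:R by rewrite divr_ge0 //; lra.
  have h3 : N.-1%:R * (B / N%:R) <= B.
    apply: (@le_trans _ _ (N%:R * (B / N%:R))); first by rewrite ler_wpM2r // ler_nat leq_pred.
    by rewrite mulrC divfK ?gt_eqF.
  have Q0 : 0 <= Q by case/andP: hQ; lra.
  have h2 : N%:R * P2 <= 4 * B * Q.
    have : N%:R * P2 <= 2 * (N.-1%:R * P2) by rewrite mulrA ler_wpM2r //; lra.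
    have : (1 + N.-1%:R * (B / N%:R)) * Q <= 2 * B * Q by rewrite ler_wpM2r //; lra.
    by lra.
  have -> : z * t%:R ^+ 2 * P2 = t%:R * (N%:R * P2 / B ^+ 3).
    by rewrite /z; field; rewrite !gt_eqF //; lra.
  rewrite [leRHS]mulrC ler_wpM2l // ler_pdivrMr //; apply: (le_trans h2).
  have -> : 8 * B ^+ 3 = 4 * B * (2 * B ^+ 2) by ring.
  by rewrite ler_wpM2l //; [lra|case/andP: hQ].
(* The strict inequality [t < 2 * u] provides the [+ 1], which reduces the factor
   [N = expR (B ^+ 2)] to [expR (7 / 12 * B ^+ 2)]. *)
have huQ : 5 / 12 * (t%:R + 1) * B ^+ 2 <= 11 / 12 * (u%:R * Q).
  have : (t + 1 <= 2 * u)%N by rewrite addn1.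
  rewrite -(ler_nat R) natrD natrM => h1.
  case/andP: hQ => q1 _.
  have e1 : u%:R * (10 / 11 * B ^+ 2) <= u%:R * Q by rewrite ler_wpM2l.
  have e2 : (t%:R + 1) * B ^+ 2 <= (2 * u%:R) * B ^+ 2 by rewrite ler_wpM2r //; lra.
  by lra.
have {}hPr : Pr p (fun f => bad_pair f U T) <=
    (z ^+ (t - 1))^-1 * expR (8 * t%:R - 5 / 12 * (t%:R + 1) * B ^+ 2).
  apply: (le_trans hPr); rewrite ler_wpM2l ?invr_ge0 ?exprn_ge0 // ?ler_expR; lra.
have Cz : 'C(N, t)%:R * (z ^+ (t - 1))^-1 <= N%:R * expR t%:R * (B ^+ 3) ^+ t.
  have zt : (z ^+ (t - 1))^-1 <= z * (t%:R / N%:R * B ^+ 3) ^+ t.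
    have -> : t%:R / N%:R * B ^+ 3 = z^-1.
      by rewrite /z; field; rewrite !gt_eqF //; lra.
    by rewrite -[in leRHS](prednK t0) subn1 exprVn exprS invfM mulrA mulfV ?mul1r // gt_eqF.
  apply: (le_trans (ler_wpM2l (ler0n R _) zt)).
  rewrite exprMn.
  have -> : 'C(N, t)%:R * (z * ((t%:R / N%:R) ^+ t * (B ^+ 3) ^+ t)) =
     z * ('C(N, t)%:R * (t%:R / N%:R) ^+ t) * (B ^+ 3) ^+ t by ring.
  apply: ler_wpM2r; first by rewrite exprn_ge0 // ltW.
  apply: ler_pM; [exact: ltW z0|by rewrite mulr_ge0 ?exprn_ge0 ?divr_ge0| |].
    rewrite /z ler_pdivrMr // ler_peMr //.
    by apply: mulr_ege1 => //; lra.
  rewrite expr_div_n mulrA ler_pdivrMr ?exprn_gt0 // [leRHS]mulrC; exact: bin_mul_expn_le.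
have two : 2 ^+ t <= expR t%:R :> R.
  rewrite -[t%:R]mulr1 expRM_natl lerXn2r ?nnegrE ?expR_ge0 //.
  by apply: le_trans (expR_ge1Dx _); lra.
apply: (@le_trans _ _ (N%:R * expR t%:R * (B ^+ 3) ^+ t * expR t%:R *
     expR (8 * t%:R - 5 / 12 * (t%:R + 1) * B ^+ 2))).
  have e8 := expR_ge0 (8 * t%:R - 5 / 12 * (t%:R + 1) * B ^+ 2).
  apply: (le_trans (ler_wpM2l _ hPr)); first by rewrite mulr_ge0 ?exprn_ge0.
  rewrite mulrA; apply: ler_wpM2r => //; rewrite [leLHS]mulrAC; apply: ler_pM => //.
  by rewrite mulr_ge0 // invr_ge0 exprn_ge0 // ltW.
set b := (B ^+ 3) ^+ t.
rewrite (exprMn t (expR 10 * _)) (exprMn t (expR 10)) -/b -!expRM_natl.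
have -> : N%:R = expR (B ^+ 2) by rewrite -LB lnK ?posrE.
have b0 : 0 <= b by rewrite exprn_ge0 // ltW.
have -> : expR (B ^+ 2) * expR t%:R * b * expR t%:R *
    expR (8 * t%:R - 5 / 12 * (t%:R + 1) * B ^+ 2) =
  b * (expR (B ^+ 2) * expR t%:R * expR t%:R *
    expR (8 * t%:R - 5 / 12 * (t%:R + 1) * B ^+ 2)) by ring.
have -> : expR (7 / 12 * B ^+ 2) * (expR (t%:R * 10) * b * expR (t%:R * - (5 / 12 * B ^+ 2))) =
  b * (expR (7 / 12 * B ^+ 2) * expR (t%:R * 10) * expR (t%:R * - (5 / 12 * B ^+ 2))) by ring.
by rewrite -!expRD ler_wpM2l // ler_expR; lra.
Qed.

End Bounds.
End BadEvents.


Section BadEventProbabilities.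
Import mathcomp.boot.fintype mathcomp.boot.finset.
Local Open Scope ring_scope.
Variables (R : realType) (N : nat) (I : finType) (p : I -> R) (B : R).
Let Q := \sum_i qprob N (p i).

(** Beyond [N / B ^+ 3] vertices the binomial coefficient is at most [(e B ^+ 3) ^+ |T|], so
    separation alone beats it, even with the cruder [contact] bound. *)
Lemma Pr_bad_pair_large (U T : {set 'I_N}) : dense_regime N p B ->
  U \subset T -> (#|T| < 2 * #|U|)%N -> (2 * #|T| <= N)%N -> N%:R < #|T|%:R * B ^+ 3 ->
  'C(N, #|T|)%:R * 2 ^+ #|T| * Pr p (fun f => bad_pair f U T) <=
  (2 * expR 1 * B ^+ 3 * expR (- (B / 16))) ^+ #|T|.
Proof.
move=> H UT T2U T2N tB; have [N0 /andP[hB hpB] LB hp /andP[hQ _]] := H; rewrite -/Q in hQ.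
have [NR0 hp1 hNp] := dense_regime_bounds H.
have dU : [disjoint U & ~: T] by rewrite disjoints_subset setCK.
have hPr : Pr p (fun f => bad_pair f U T) <= expR (- \sum_i contact (p i) #|U| #|~: T|).
  by apply: le_trans (Pr_separated_le hp1 dU); apply: Pr_le => // f /andP[].
have cT : #|~: T| = (N - #|T|)%N by rewrite -[LHS](addKn #|T|) cardsC card_ord.
rewrite cT in hPr.
set t := #|T| in T2U T2N tB hPr *; set u := #|U| in T2U hPr.
have uN : (u <= N)%N by rewrite -[leqRHS]card_ord max_card.
have := sum_contact_ge H uN (leq_subr t N); rewrite -/Q.
set S := \sum_i _ in hPr *; move=> hS.
have tu : t%:R <= 2 * u%:R :> R by rewrite -natrM ler_nat ltnW.
have yN : N%:R / 2 <= (N - t)%:R :> R.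
  rewrite natrB; last by apply: leq_trans T2N; rewrite leq_pmull.
  by move: T2N; rewrite -(ler_nat R) natrM; lra.
have B2 : B ^+ 2 / 2 <= Q by have := sqr_ge0 B; lra.
have hS2 : t%:R * B / 16 <= S.
  have e0 : t%:R / 2 * (N%:R / 2) * (B ^+ 2 / 2) <= u%:R * (N - t)%:R * Q.
    apply: ler_pM; [by rewrite mulr_ge0 ?divr_ge0|by rewrite divr_ge0 ?sqr_ge0| |exact: B2].
    by apply: ler_pM; [by rewrite divr_ge0|by rewrite divr_ge0|lra|exact: yN].
  have e1 := le_trans e0 hS.
  have BN0 : 0 < 2 * B * N%:R by rewrite mulr_gt0 //; lra.
  rewrite -(ler_pM2l BN0); apply: le_trans e1.
  by rewrite le_eqVlt; apply/orP; left; apply/eqP; field.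
have t0 : (0 < t)%N.
  rewrite lt0n; apply/eqP => t0; move: tB; rewrite t0 mul0r; lra.
have tR : 0 < t%:R :> R by rewrite ltr0n.
have Ct : 'C(N, t)%:R <= expR 1 ^+ t * (B ^+ 3) ^+ t :> R.
  rewrite -(ler_pM2r (exprn_gt0 t tR)); apply: (le_trans (bin_mul_expn_le R N t)).
  rewrite -[in leLHS](mulr1 t%:R) expRM_natl [leLHS]mulrC -[leRHS]mulrA -[(B ^+ 3) ^+ t * _]exprMn.
  apply: ler_wpM2l; first by rewrite exprn_ge0 // expR_ge0.
  by rewrite lerXn2r ?nnegrE ?mulr_ge0 ?exprn_ge0 //; lra.
have hE : expR (- S) <= expR (- (B / 16)) ^+ t.
  by rewrite -expRM_natl ler_expR mulrN lerN2 mulrA.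
have -> : (2 * expR 1 * B ^+ 3 * expR (- (B / 16))) ^+ t =
   expR 1 ^+ t * (B ^+ 3) ^+ t * 2 ^+ t * expR (- (B / 16)) ^+ t.
  by rewrite 3!exprMn; ring.
apply: ler_pM; rewrite ?mulr_ge0 ?exprn_ge0 ?Pr_ge0 //; last exact: le_trans hE.
by apply: ler_wpM2r => //; rewrite exprn_ge0.
Qed.

(** Keeps [k] factors [2 x], which make the total small, and leaves a geometric sequence to be
    summed over [t]. *)
Lemma expr_le_half (x : R) (k t : nat) : 0 <= x <= 2^-1 -> (k <= t)%N ->
  x ^+ t <= 2 ^+ k * x ^+ k * 2^-1 ^+ t.
Proof.
case/andP=> x0 x1 kt; rewrite -(subnK kt) !exprD.
have -> : 2 ^+ k * x ^+ k * (2^-1 ^+ (t - k) * 2^-1 ^+ k) =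
   (2 * 2^-1) ^+ k * (2^-1 ^+ (t - k) * x ^+ k) by rewrite exprMn; ring.
rewrite mulfV // expr1n mul1r ler_wpM2r ?exprn_ge0 // lerXn2r ?nnegrE //; lra.
Qed.

Lemma Pr_bad_pairs (h : nat) (w : R) : dense_regime N p B -> (6 * h <= N)%N ->
  expR 10 * B ^+ 3 * expR (- (5 / 12 * B ^+ 2)) <= 2^-1 ->
  expR (7 / 12 * B ^+ 2) * (4 * (expR 10 * B ^+ 3 * expR (- (5 / 12 * B ^+ 2))) ^+ 2) <= w ->
  2 * expR 1 * B ^+ 3 * expR (- (B / 16)) <= 2^-1 ->
  2 * (2 * expR 1 * B ^+ 3 * expR (- (B / 16))) <= w ->
  Pr p (fun f => [exists x : {set 'I_N} * {set 'I_N},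
     [&& x.1 \subset x.2, (#|x.2| < 2 * #|x.1|)%N & (1 < #|x.1| < h)%N] && bad_pair f x.1 x.2])
  <= 2 * w.
Proof.
move=> H h6 rho1 rho2 sig1 sig2; have [N0 /andP[hB hpB] LB hp hQ] := H.
have [NR0 hp1 hNp] := dense_regime_bounds H.
set rho := expR 10 * _ * _ in rho1 rho2; set sig := _ * expR (- (B / 16)) in sig1 sig2.
have B30 : 0 <= B ^+ 3 by rewrite exprn_ge0 //; lra.
have rho0 : 0 <= rho <= 2^-1.
  by rewrite rho1 andbT (mulr_ge0 (mulr_ge0 (expR_ge0 _) B30) (expR_ge0 _)).
have sig0 : 0 <= sig <= 2^-1.
  rewrite sig1 andbT.
  exact: mulr_ge0 (mulr_ge0 (mulr_ge0 (ler0n R 2) (expR_ge0 _)) B30) (expR_ge0 _).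
have w0 : 0 <= w by apply: le_trans sig2; rewrite mulr_ge0 //; case/andP: sig0.
apply: (le_trans (Pr_exists _ _ hp1)).
(* Chosen so that the sum over the ['C(N, t)] sets [T] and their [2 ^+ t] subsets leaves
   [w * 2^-1 ^+ t]. *)
pose F (t : nat) : R := w * 2^-1 ^+ t / ('C(N, t)%:R * 2 ^+ t).
have F0 t : 0 <= F t by rewrite divr_ge0 ?mulr_ge0 ?exprn_ge0 // invr_ge0.
have main (U T : {set 'I_N}) : U \subset T -> (#|T| < 2 * #|U|)%N -> (1 < #|U| < h)%N ->
    Pr p (fun f => bad_pair f U T) <= F #|T|.
  move=> UT T2U /andP[U1 Uh].
  have T2N : (2 * #|T| <= N)%N by clear -T2U Uh h6; lia.
  set t := #|T| in T2U T2N *.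
  have t2 : (2 <= t)%N by apply: (leq_trans U1); apply: subset_leq_card.
  have tN : (t <= N)%N by rewrite -[leqRHS]card_ord max_card.
  have C0 : 0 < 'C(N, t)%:R * 2 ^+ t :> R by rewrite mulr_gt0 ?exprn_gt0 // ltr0n bin_gt0.
  rewrite /F ler_pdivlMr // mulrC.
  have [tB|tB] := leP (t%:R * B ^+ 3) N%:R.
    apply: (le_trans (Pr_bad_pair_small H UT T2U U1 tB)); rewrite -/rho -/t.
    have := expr_le_half rho0 t2 => hr.
    apply: (le_trans (ler_wpM2l (expR_ge0 _) hr)).
    by rewrite mulrA; apply: ler_wpM2r; rewrite ?exprn_ge0 ?invr_ge0 // expr2; lra.
  apply: (le_trans (Pr_bad_pair_large H UT T2U T2N tB)); rewrite -/sig -/t.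
  have := expr_le_half sig0 (ltnW t2); rewrite !expr1 => hr.
  by apply: (le_trans hr); apply: ler_wpM2r; rewrite ?exprn_ge0 ?invr_ge0.
apply: (@le_trans _ _ (\sum_(x : {set 'I_N} * {set 'I_N} | x.1 \subset x.2) F #|x.2|)).
  rewrite [leLHS]big_mkcond [leRHS]big_mkcond; apply: ler_sum => -[U T] _ /=.
  case: (boolP (U \subset T)) => UT //=; case: ifP => // /andP[h1 h2]; exact: main.
have -> : \sum_(x : {set 'I_N} * {set 'I_N} | x.1 \subset x.2) F #|x.2| =
   \sum_(T : {set 'I_N}) 2 ^+ #|T| * F #|T|.
  rewrite (eq_bigr (fun T : {set 'I_N} => \sum_(U : {set 'I_N} | U \subset T) F #|T|)).
    by rewrite [RHS](exchange_big_dep xpredT) //= [RHS]pair_big_dep.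
  move=> T _; rewrite sumr_const -[RHS]mulr_natl -natrX -card_powerset; congr (_%:R * _).
  by apply: eq_card => U; rewrite powersetE.
rewrite (sum_set_card _ (fun t => 2 ^+ t * F t)) card_ord.
apply: (@le_trans _ _ (\sum_(t < N.+1) w * 2^-1 ^+ t)); last first.
  by rewrite -mulr_sumr mulrC ler_wpM2r // sum_half_pow.
apply: ler_sum => t _; rewrite /F mulrA [leLHS]mulrC divfK //.
by rewrite mulf_neq0 ?expf_neq0 // pnatr_eq0 -lt0n bin_gt0 -ltnS.
Qed.

(** [256] is [8 * 8 * 2 * 2]: two sets of at least [N / 8] vertices, [Q >= B ^+ 2 / 2], and the
    factor [2 * B * N] of [contact_ge]. The number of pairs of sets is [4 ^ N], at most
    [expR (2 * N)]. *)
Lemma Pr_separated_pairs (h : nat) : dense_regime N p B -> (h <= N)%N -> (N <= 8 * h)%N ->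
  Pr p (fun f => [exists x : {set 'I_N} * {set 'I_N},
     [&& #|x.1| == h, #|x.2| == h & [disjoint x.1 & x.2]] && separated f x.1 x.2])
  <= expR (N%:R * (2 - B / 256)).
Proof.
move=> H hN h8; have [N0 /andP[hB hpB] LB hp /andP[hQ _]] := H; rewrite -/Q in hQ.
have [NR0 hp1 hNp] := dense_regime_bounds H.
apply: (le_trans (Pr_exists _ _ hp1)).
apply: (@le_trans _ _ (\sum_(x : {set 'I_N} * {set 'I_N}) expR (- (N%:R * B / 256)))).
  rewrite [leLHS]big_mkcond; apply: ler_sum => -[X Y] _ /=.
  case: ifP => [/and3P[/eqP cX /eqP cY dXY]|_]; last exact: expR_ge0.
  apply: (le_trans (Pr_separated_le hp1 dXY)); rewrite cX cY ler_expR lerN2.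
  have := sum_contact_ge H hN hN; rewrite -/Q; set S := \sum_i _ => hS.
  have h8' : N%:R / 8 <= h%:R :> R by move: h8; rewrite -(ler_nat R) natrM; lra.
  have B2 : B ^+ 2 / 2 <= Q by have := sqr_ge0 B; lra.
  have e0 : N%:R / 8 * (N%:R / 8) * (B ^+ 2 / 2) <= h%:R * h%:R * Q.
    apply: ler_pM; [by rewrite mulr_ge0 ?divr_ge0|by rewrite divr_ge0 ?sqr_ge0| |exact: B2].
    by apply: ler_pM; [by rewrite divr_ge0|by rewrite divr_ge0|exact: h8'|exact: h8'].
  have e1 := le_trans e0 hS.
  have BN0 : 0 < 2 * B * N%:R by rewrite mulr_gt0 //; lra.
  rewrite -(ler_pM2l BN0); apply: le_trans e1.
  by rewrite le_eqVlt; apply/orP; left; apply/eqP; field.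
have c2 : #|{: {set 'I_N}}| = (2 ^ N)%N.
  by rewrite -cardsT -powersetT card_powerset cardsT card_ord.
rewrite sumr_const card_prod c2 -[leLHS]mulr_natr natrM natrX.
have two : 2 ^+ N <= expR N%:R :> R.
  rewrite -[X in expR X]mulr1 expRM_natl lerXn2r ?nnegrE ?expR_ge0 //.
  by apply: le_trans (expR_ge1Dx _); lra.
apply: (@le_trans _ _ (expR (- (N%:R * B / 256)) * (expR N%:R * expR N%:R))).
  by rewrite ler_wpM2l ?expR_ge0 // ler_pM ?exprn_ge0.
by rewrite -!expRD ler_expR; lra.
Qed.

End BadEventProbabilities.

(** * Asymptotics *)

Section Threshold.
Import mathcomp.boot.fintype mathcomp.boot.finset.
Local Open Scope ring_scope.
Variable R : realType.

Lemma Pr_perfect_matching_ge (N : nat) (I : finType) (p : I -> R) (B w : R) :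
  dense_regime N p B -> ~~ odd N ->
  expR 10 * B ^+ 3 * expR (- (5 / 12 * B ^+ 2)) <= 2^-1 ->
  expR (7 / 12 * B ^+ 2) * (4 * (expR 10 * B ^+ 3 * expR (- (5 / 12 * B ^+ 2))) ^+ 2) <= w ->
  2 * expR 1 * B ^+ 3 * expR (- (B / 16)) <= 2^-1 ->
  2 * (2 * expR 1 * B ^+ 3 * expR (- (B / 16))) <= w ->
  Pr p (@no_isolated 'I_N I) - (2 * w + expR (N%:R * (2 - B / 256))) <=
  Pr p (fun f : {ffun I -> {set 'I_N}} => has_perfect_matching (share f)).
Proof.
move=> H eN c1 c2 c3 c4; have [N0 _ _ _ _] := H; have [_ hp1 _] := dense_regime_bounds H.
(* From [N >= 56] on, the remainder is at most [h], whence [N <= 8 * h]. *)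
pose h := (N %/ 7)%N.
have [h0 h7 h6 h8] : [/\ (0 < h)%N, (7 * h <= N)%N, (6 * h <= N)%N & (N <= 8 * h)%N].
  by rewrite /h; clear -N0; split; lia.
have hN : (h <= N)%N by apply: leq_div.
have b1 := Pr_bad_pairs H h6 c1 c2 c3 c4; have b2 := Pr_separated_pairs H hN h8.
rewrite lerBlDr; apply: le_trans (lerD (lexx _) (lerD b1 b2)).
rewrite /Pr -!ExD; apply: Ex_le => // f; rewrite -!natrD ler_nat.
case: (boolP (no_isolated f)) => // /no_isolatedP niso.
case: (boolP [exists x : {set 'I_N} * {set 'I_N}, _ && bad_pair f x.1 x.2]) => [_|/existsPn nb1].
  by rewrite addnCA.
case: (boolP [exists x : {set 'I_N} * {set 'I_N}, _ && separated f x.1 x.2]) => [_|/existsPn nb2].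
  by rewrite addnA addn1.
rewrite !addn0; suff -> : has_perfect_matching (share f) by [].
apply: (@separated_perfect_matching _ _ f h); rewrite ?card_ord //.
- move=> U T UT TU Uh sep ex; have := nb1 (U, T).
  by rewrite /= /bad_pair UT TU Uh sep ex.
- move=> X Y cX cY dXY sep; have := nb2 (X, Y).
  by rewrite /= cX cY dXY sep eqxx.
Qed.

Local Open Scope classical_set_scope.

Lemma expr_expRN_small (k : nat) (c e : R) : 0 < c -> 0 < e ->
  \forall B \near +oo, B ^+ k * expR (- (c * B)) <= e.
Proof.
move=> c0 e0; near=> B.
have B0 : 0 < B by near: B; apply: nbhs_pinfty_gt; rewrite num_real.
have BM : (k.+1)`!%:R / (c ^+ k.+1 * e) <= B.
  by near: B; apply: nbhs_pinfty_ge; rewrite num_real.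
have cB : 0 < c * B by rewrite mulr_gt0.
have f0 : 0 < (k.+1)`!%:R :> R by rewrite ltr0n fact_gt0.
have ck : 0 < c ^+ k.+1 by rewrite exprn_gt0.
have h := expR_ge1Dxn k (ltW cB).
rewrite expRN ler_pdivrMr ?expR_gt0 //.
apply: (@le_trans _ _ (e * ((c * B) ^+ k.+1 / (k.+1)`!%:R))); last first.
  apply: (ler_wpM2l (ltW e0)); apply: le_trans h; by rewrite lerDr.
rewrite exprMn [B ^+ k.+1]exprS mulrA ler_pdivlMr // .
have -> : e * (c ^+ k.+1 * (B * B ^+ k)) = B ^+ k * (B * (c ^+ k.+1 * e)) by ring.
apply: ler_wpM2l; first by rewrite exprn_ge0 // ltW.
by rewrite -ler_pdivrMr // mulr_gt0.
Unshelve. all: by end_near. Qed.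

Lemma near_sqrt_ln (P : R -> Prop) : (\forall B \near +oo, P B) ->
  \forall N \near \oo, P (Num.sqrt (ln (N%:R : R))).
Proof.
case=> M [_ hM]; near=> N; apply: hM.
have MN : expR ((`|M| + 1) ^+ 2) <= N%:R by near: N; exact: nbhs_infty_ger.
have N0 : 0 < (N%:R : R) by apply: lt_le_trans MN; apply: expR_gt0.
have : (`|M| + 1) ^+ 2 <= ln (N%:R : R) by rewrite -ler_expR lnK ?posrE.
move/ler_wsqrtr; rewrite sqrtr_sqr => h; apply: lt_le_trans h.
apply: (@le_lt_trans _ _ `|M|); first exact: ler_norm.
by apply: lt_le_trans (ler_norm _); rewrite ltrDl.
Unshelve. all: by end_near. Qed.

Lemma near_double (P : nat -> Prop) : (\forall N \near \oo, P N) ->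
  \forall n \near \oo, P (2 * n)%N.
Proof.
case=> M _ hM; exists M => // n /= Mn; apply: hM => /=.
by apply: leq_trans Mn _; rewrite leq_pmull.
Qed.

(* With [B = sqrt (ln N)]: the geometric ratios and the totals of the union
   bounds, and the deviation from the threshold. *)
Definition negligible_errors (B w : R) :=
  [/\ 768 <= B,
    expR 10 * B ^+ 3 * expR (- (5 / 12 * B ^+ 2)) <= 2^-1,
    expR (7 / 12 * B ^+ 2) * (4 * (expR 10 * B ^+ 3 * expR (- (5 / 12 * B ^+ 2))) ^+ 2) <= w &
    2 * expR 1 * B ^+ 3 * expR (- (B / 16)) <= 2^-1] /\
  [/\ 2 * (2 * expR 1 * B ^+ 3 * expR (- (B / 16))) <= w,
    expR (- B) <= w & 8 * B ^+ 3 * expR (- B ^+ 2) <= w].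

Lemma near_negligible_errors (w : R) : 0 < w -> \forall B \near +oo, negligible_errors B w.
Proof.
move=> w0; near=> B.
have B1 : 768 <= B by near: B; apply: nbhs_pinfty_ge; rewrite num_real.
have e10 := expR_gt0 (10 : R); have e1 := expR_gt0 (1 : R).
have h1 : B ^+ 3 * expR (- (5 / 12 * B)) <= 2^-1 / expR 10.
  by near: B; apply: expr_expRN_small; rewrite ?divr_gt0.
have h2 : B ^+ 6 * expR (- (1 / 4 * B)) <= w / (4 * expR 10 ^+ 2).
  by near: B; apply: expr_expRN_small; rewrite ?divr_gt0 ?mulr_gt0 ?exprn_gt0.
have h3 : B ^+ 3 * expR (- (1 / 16 * B)) <= 2^-1 / (2 * expR 1).
  by near: B; apply: expr_expRN_small; rewrite ?divr_gt0 ?mulr_gt0.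
have h4 : B ^+ 3 * expR (- (1 / 16 * B)) <= w / (2 * (2 * expR 1)).
  by near: B; apply: expr_expRN_small; rewrite ?divr_gt0 ?mulr_gt0.
have h5 : B ^+ 0 * expR (- (1 * B)) <= w by near: B; apply: expr_expRN_small.
have h6 : B ^+ 3 * expR (- (1 * B)) <= w / 8.
  by near: B; apply: expr_expRN_small; rewrite ?divr_gt0.
have B0 : 0 <= B := le_trans (ler0n R 768) B1.
have BB : B <= B ^+ 2 by rewrite expr2 ler_peMr // (le_trans _ B1) // ler1n.
have ex (c : R) : 0 <= c -> expR (- (c * B ^+ 2)) <= expR (- (c * B)).
  by move=> c0; rewrite ler_expR lerN2 ler_wpM2l.
have c5 : 0 <= 5 / 12 :> R by rewrite divr_ge0.
have c4 : 0 <= 1 / 4 :> R by rewrite divr_ge0.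
have b3 : 0 <= B ^+ 3 by rewrite exprn_ge0.
have eB : expR (- (B / 16)) = expR (- (1 / 16 * B)) by rewrite mulrC div1r.
split; split=> //.
- rewrite -mulrA mulrC -ler_pdivlMr //; apply: le_trans h1; exact: ler_wpM2l (ex _ c5).
(* [7 / 12 - 2 * 5 / 12 = - 1 / 4]: the square is available because [T] has at least two
   vertices. *)
- have -> : expR (7 / 12 * B ^+ 2) * (4 * (expR 10 * B ^+ 3 * expR (- (5 / 12 * B ^+ 2))) ^+ 2) =
    (B ^+ 6 * expR (- (1 / 4 * B ^+ 2))) * (4 * expR 10 ^+ 2).
    have -> : - (1 / 4 * B ^+ 2) = 7 / 12 * B ^+ 2 + (- (5 / 12 * B ^+ 2) - (5 / 12 * B ^+ 2)) by field.
    by rewrite !expRD; ring.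
  rewrite -ler_pdivlMr ?mulr_gt0 ?exprn_gt0 //; apply: le_trans h2.
  by apply: (ler_wpM2l (exprn_ge0 6 B0)); apply: ex.
- by rewrite eB -mulrA mulrC -ler_pdivlMr ?mulr_gt0.
- rewrite eB (_ : 2 * _ = B ^+ 3 * expR (- (1 / 16 * B)) * (2 * (2 * expR 1))); last by ring.
  by rewrite -ler_pdivlMr ?mulr_gt0.
- by move: h5; rewrite expr0 !mul1r.
- rewrite -mulrA mulrC -ler_pdivlMr //; apply: le_trans h6; apply: ler_wpM2l => //.
  by rewrite mul1r ler_expR lerN2.
Unshelve. all: by end_near. Qed.

Lemma ln_sqrt_sqr (N : nat) : (0 < N)%N -> Num.sqrt (ln (N%:R : R)) ^+ 2 = ln N%:R.
Proof. by move=> N0; rewrite sqr_sqrtr // ln_ge0 // ler1n. Qed.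

Lemma ln_le_id (N : nat) : (0 < N)%N -> ln (N%:R : R) <= N%:R - 1.
Proof.
move=> N0; have := expR_ge1Dx (ln (N%:R : R)); rewrite lnK ?posrE ?ltr0n //; lra.
Qed.

(** Since [1 / N = expR (- B ^+ 2)], the bound [8 * B ^+ 3 / N] on the sum of squares becomes a
    function of [B] alone. The assumption on [a] yields [Q >= 10 / 11 * B ^+ 2]. *)
Lemma dense_regime_near_threshold (N : nat) (I : finType) (p : I -> R) (a B : R) :
  (56 <= N)%N -> ln N%:R = B ^+ 2 -> 24 <= B -> 11 * (`|a| + 1) <= B ^+ 2 ->
  (forall i, 0 <= p i <= B / N%:R) -> 
  `|\sum_i qprob N (p i) - ln N%:R - a| <= B / N%:R ->
  dense_regime N p B /\ near_threshold N p a (8 * B ^+ 3 * expR (- B ^+ 2)).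
Proof.
move=> N0 LB B24 aB hp hQ.
have Npos : (0 < N)%N by apply: leq_trans N0.
have NR0 : 0 < N%:R :> R by rewrite ltr0n.
have NR56 : 56 <= N%:R :> R by rewrite (ler_nat R 56).
have NE : expR (- B ^+ 2) = N%:R^-1 by rewrite -LB expRN lnK ?posrE.
have hl := ln_le_id Npos; rewrite LB in hl.
have BB : B * 24 <= B ^+ 2 by rewrite expr2 ler_wpM2l //; lra.
have BN : B <= N%:R by lra.
have BN1 : B / N%:R <= 1 by rewrite ler_pdivrMr ?mul1r.
have h11 : 11 * `|a| + 11 <= B ^+ 2 by lra.
move: (hQ); rewrite LB ler_norml => /andP[hQ1 hQ2].
have ha1 := ler_norm a; have ha2 := ler_norm (- a); rewrite normrN in ha2.
have na0 := normr_ge0 a.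
have D : dense_regime N p B by split=> //; apply/andP; split; lra.
split=> //; rewrite NE.
have B3 : B <= 8 * B ^+ 3.
  have : 0 <= B * (8 * B ^+ 2 - 1) by rewrite mulr_ge0 //; lra.
  by rewrite mulrBr mulr1 mulrCA -exprS; lra.
have BN8 : B / N%:R <= 8 * B ^+ 3 * N%:R^-1 by rewrite ler_wpM2r // invr_ge0 ltW.
split=> [i||]; last exact: le_trans BN8.
  by have /andP[p0 p1] := hp i; rewrite p0 (le_trans p1).
have [_ _ _ _ /andP[Q1 Q2]] := D.
have Q0 : 0 <= \sum_i qprob N (p i) by apply: le_trans Q1; rewrite mulr_ge0 ?divr_ge0 ?sqr_ge0.
have [_ hp1 _] := dense_regime_bounds D.
have h := sum_sqr_le N hp1 (fun i => proj2 (andP (hp i))).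
have P20 : 0 <= \sum_i p i ^+ 2 by apply: sumr_ge0 => i _; apply: sqr_ge0.
have n1 : N%:R = N.-1%:R + 1 :> R by rewrite natr1 prednK.
have h3 : N.-1%:R * (B / N%:R) <= B.
  apply: (@le_trans _ _ (N%:R * (B / N%:R))); last by rewrite mulrC divfK ?gt_eqF.
  by rewrite ler_wpM2r ?divr_ge0 ?ler_nat ?leq_pred //; lra.
rewrite ler_pdivlMr // mulrC.
move: P20 h Q0 Q2 h3 n1 B24 NR56.
move: (\sum_i p i ^+ 2) (\sum_i qprob N (p i)) (B / N%:R) => P2 Q r; clear.
move=> P20 h Q0 Q2 h3 n1 B24 NR56.
have e1 : N%:R * P2 <= 2 * (N.-1%:R * P2) by rewrite mulrA ler_wpM2r //; lra.
have e2 : (1 + N.-1%:R * r) * Q <= 2 * B * (2 * B ^+ 2).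
  apply: (@le_trans _ _ (2 * B * Q)); first by rewrite ler_wpM2r //; lra.
  by rewrite ler_wpM2l //; lra.
by rewrite (_ : 8 * B ^+ 3 = 2 * (2 * B * (2 * B ^+ 2))); [lra|ring].
Qed.

End Threshold.

Section Asymptotics.
Local Open Scope ring_scope.
Local Open Scope classical_set_scope.
Variable R : realType.

Lemma Pr_perfect_matching_ge_no_isolated (N : nat) (I : finType) (p : I -> R) (a B w : R) :
  (56 <= N)%N -> ~~ odd N -> ln N%:R = B ^+ 2 -> 11 * (`|a| + 1) <= B ^+ 2 ->
  (forall i, 0 <= p i <= B / N%:R) ->
  `|\sum_i qprob N (p i) - ln N%:R - a| <= B / N%:R ->
  negligible_errors B w ->
  Pr p (@no_isolated 'I_N I) - 3 * w <=
  Pr p (fun f : {ffun I -> {set 'I_N}} => has_perfect_matching (share f)).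
Proof.
move=> N0 eN LB aB hp hQ [[B768 c1 c2 c3] [c4 c5 _]].
have B24 : 24 <= B by clear -B768; lra.
have [D _] := dense_regime_near_threshold N0 LB B24 aB hp hQ.
apply: le_trans (Pr_perfect_matching_ge D eN c1 c2 c3 c4).
have [_ /andP[_ BN] _ _ _] := D.
suff : expR (N%:R * (2 - B / 256)) <= w by clear; lra.
apply: le_trans c5; rewrite ler_expR.
(* As [768 = 3 * 256], the exponent is at most [- N], hence at most [- B]. *)
have : 0 <= N%:R * (B / 256 - 3) by rewrite mulr_ge0 //; clear -B768; lra.
by move: BN; clear; lra.
Qed.

Lemma near_perfect_matching_thin (a e : R) : 0 < e ->
  \forall N \near \oo, ~~ odd N -> forall (I : finType) (p : I -> R),
    (forall i, 0 <= p i <= Num.sqrt (ln (N%:R : R)) / N%:R) ->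
    `|\sum_i qprob N (p i) - ln N%:R - a| <= Num.sqrt (ln (N%:R : R)) / N%:R ->
    expR (- expR (- a)) - e <=
    Pr p (fun f : {ffun I -> {set 'I_N}} => has_perfect_matching (share f)).
Proof.
move=> e0; have e2 : 0 < e / 2 by rewrite divr_gt0.
have w0 : 0 < e / 6 by rewrite divr_gt0.
pose d (N : nat) : R :=
  8 * Num.sqrt (ln (N%:R : R)) ^+ 3 * expR (- Num.sqrt (ln (N%:R : R)) ^+ 2).
have d0 : d @ \oo --> (0 : R).
  apply/cvgrPdist_le => x x0; have := near_sqrt_ln (near_negligible_errors x0).
  apply: filterS => N [_ [_ _ h]]; rewrite sub0r normrN ger0_norm //.
  by rewrite /d !mulr_ge0 ?expR_ge0 ?exprn_ge0 ?sqrtr_ge0.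
have H1 := Pr_no_isolated_cvg a d0 e2.
have H2 := near_sqrt_ln (near_negligible_errors w0).
have H3 := near_sqrt_ln (nbhs_pinfty_ge (num_real (11 * (`|a| + 1)))).
have H4 : \forall N \near \oo, (56 <= N)%N by exact: nbhs_infty_ge.
near=> N.
have B1 : negligible_errors (Num.sqrt (ln (N%:R : R))) (e / 6) by near: N; exact: H2.
have aB : 11 * (`|a| + 1) <= Num.sqrt (ln (N%:R : R)) by near: N; exact: H3.
have N56 : (56 <= N)%N by near: N; exact: H4.
have P1 : forall (I : finType) (p : I -> R), near_threshold N p a (d N) ->
    `|Pr p (@no_isolated 'I_N I) - expR (- expR (- a))| <= e / 2 by near: N; exact: H1.
move=> eN I p; rewrite /d in P1; move: B1 aB P1 N56 eN.
have := @ln_sqrt_sqr R N.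
move: (Num.sqrt _) => B; clear -e0 => LB B1 aB P1 N56 eN hp hQ.
have {}LB : ln N%:R = B ^+ 2 by rewrite LB //; apply: leq_trans N56.
have [[B768 _ _ _] _] := B1.
have B24 : 24 <= B by clear -B768; lra.
have aB2 : 11 * (`|a| + 1) <= B ^+ 2.
  by apply: (le_trans aB); rewrite expr2 ler_peMr //; clear -B24; lra.
have [_ T] := dense_regime_near_threshold N56 LB B24 aB2 hp hQ.
apply: le_trans (Pr_perfect_matching_ge_no_isolated N56 eN LB aB2 hp hQ B1).
by have := P1 _ _ T; rewrite ler_norml => /andP[+ _]; clear; lra.
Unshelve. all: by end_near. Qed.

(** The gap [a' - a] pays for the splitting: one half covers [expR (- (B / 8)) * B ^+ 2], the other
    [expR (- (B / 8)) * a']. *)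
Lemma near_perfect_matching (a a' e : R) : a < a' -> 0 < e ->
  \forall N \near \oo, ~~ odd N -> forall (I : finType) (p : I -> R),
    (forall i, 0 < p i <= 2^-1) -> a' <= \sum_i qprob N (p i) - ln N%:R ->
    expR (- expR (- a)) - e <=
    Pr p (fun f : {ffun I -> {set 'I_N}} => has_perfect_matching (share f)).
Proof.
move=> aa' e0; have h0 : 0 < (a' - a) / 2 by rewrite divr_gt0 ?subr_gt0.
have na : 0 < `|a'| + 1 by rewrite ltr_wpDl.
have c8 : 0 < 1 / 8 :> R by rewrite divr_gt0.
have H1 := near_perfect_matching_thin a e0.
have H2 := near_sqrt_ln (expr_expRN_small 2 c8 h0).
have H3 := near_sqrt_ln (expr_expRN_small 0 c8 (divr_gt0 h0 na)).
have H4 := near_sqrt_ln (nbhs_pinfty_ge (num_real (`|a| + `|a'| + 1))).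
have H5 : \forall N \near \oo, (2 <= N)%N by exact: nbhs_infty_ge.
near=> N => eN I p hp hQ.
have h1 : forall (I : finType) (p : I -> R),
    (forall i, 0 <= p i <= Num.sqrt (ln (N%:R : R)) / N%:R) ->
    `|\sum_i qprob N (p i) - ln N%:R - a| <= Num.sqrt (ln (N%:R : R)) / N%:R ->
    expR (- expR (- a)) - e <=
    Pr p (fun f : {ffun I -> {set 'I_N}} => has_perfect_matching (share f)).
  by move: eN; near: N; exact: H1.
have h2 : Num.sqrt (ln (N%:R : R)) ^+ 2 * expR (- (1 / 8 * Num.sqrt (ln (N%:R : R)))) <= (a' - a) / 2.
  by near: N; exact: H2.
have h3 : Num.sqrt (ln (N%:R : R)) ^+ 0 * expR (- (1 / 8 * Num.sqrt (ln (N%:R : R)))) <=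
    (a' - a) / 2 / (`|a'| + 1) by near: N; exact: H3.
have h4 : `|a| + `|a'| + 1 <= Num.sqrt (ln (N%:R : R)) by near: N; exact: H4.
have N2 : (2 <= N)%N by near: N; exact: H5.
have LB := @ln_sqrt_sqr R N (ltnW N2); have lN := @ln_le_id R N (ltnW N2).
move: (Num.sqrt _) h1 h2 h3 h4 LB; clear -aa' na hp hQ N2 lN => B h1 h2 h3 h4 LB.
rewrite -LB in hQ lN.
have a0 := normr_ge0 a; have a'0 := normr_ge0 a'.
have B1 : 1 <= B by clear -h4 a0 a'0; lra.
have BB : B <= B ^+ 2 by rewrite expr2 ler_peMr //; clear -B1; lra.
have BN : 1 <= B <= N%:R by rewrite B1 /=; clear -BB lN; lra.
have E0 := expR_ge0 (- (B / 8)).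
have E1 : expR (- (B / 8)) <= 1 by rewrite -[leRHS]expR0 ler_expR; clear -B1; lra.
have eB : 1 / 8 * B = B / 8 by rewrite mulrC div1r.
rewrite eB expr0 mul1r in h2 h3.
have E3 : expR (- (B / 8)) * a' <= (a' - a) / 2.
  move: h3; rewrite ler_pdivlMr //; apply: le_trans; apply: ler_wpM2l => //.
  by have := ler_norm a'; clear; lra.
have s0 : 0 <= ln N%:R + a.
  by rewrite -LB; have := ler_norm (- a); rewrite normrN; clear -h4 BB a'0; lra.
have [I' [p' [hp' /andP[q1 q2] hPr]]] :
  exists (I' : finType) (p' : I' -> R),
  [/\ forall i, 0 <= p' i <= B / N%:R,
      ln N%:R + a - B / N%:R <= \sum_i qprob N (p' i) <= ln N%:R + a &
      Pr p' (fun f : {ffun I' -> {set 'I_N}} => has_perfect_matching (share f)) <=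
      Pr p (fun f : {ffun I -> {set 'I_N}} => has_perfect_matching (share f))].
  apply: thin_out => //; rewrite s0 /=.
  apply: (@le_trans _ _ ((1 - expR (- (B / 8))) * (B ^+ 2 + a'))).
    by rewrite -LB mulrBl mul1r mulrDr; clear -h2 E3; lra.
  by apply: ler_wpM2l; [clear -E1; lra|clear -hQ; lra].
apply: le_trans hPr; apply: h1 => //.
have BN0 : 0 <= B / N%:R by rewrite divr_ge0 //; clear -B1; lra.
by rewrite ler_norml; apply/andP; split; clear -q1 q2 BN0; lra.
Unshelve. all: by end_near. Qed.

Lemma Pr_perfect_matching_le_no_isolated (N : nat) (I : finType) (p : I -> R) :
  (forall i, 0 <= p i <= 1) ->
  Pr p (fun f : {ffun I -> {set 'I_N}} => has_perfect_matching (share f)) <=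
  Pr p (@no_isolated 'I_N I).
Proof.
move=> hp; apply: Pr_le => // f pm; apply/no_isolatedP => v.
by have [w] := perfect_matching_nisolated (share_sym f) pm v; exists w.
Qed.

Lemma rig_Pr_perfect_matching (N m : nat) (p : 'I_m -> R) :
  rig_Pr p (fun W : features N m => has_perfect_matching (rig_adj W)) =
  Pr p (fun f : {ffun 'I_m -> {set 'I_N}} => has_perfect_matching (share f)).
Proof.
rewrite rig_PrE; apply: eq_Ex => f; congr ((nat_of_bool _)%:R).
by apply/idP/idP; apply: has_perfect_matching_mono => v w; rewrite rig_adj_transpose.
Qed.

Lemma S1E (N m : nat) (p : 'I_m -> R) : S1 p N = N%:R * \sum_i qprob N (p i).
Proof. by rewrite /S1 mulr_sumr; apply: eq_bigr => i _; rewrite /qprob mulrA. Qed.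

Lemma sqr_le_cube (B : R) : 768 <= B -> B ^+ 2 <= 8 * B ^+ 3.
Proof.
move=> B0; have B1 : 1 <= 8 * B by lra.
by rewrite [B ^+ 3]exprS mulrA ler_peMl // sqr_ge0.
Qed.

Lemma distr_le_add1 (x y : R) : `|x - y| <= 1 -> y <= x + 1.
Proof. by rewrite ler_norml => /andP[? ?]; lra. Qed.

Lemma chebyshev_exponent_le (P2 C l l' : R) : P2 <= l / 8 -> C <= l' - l -> 0 < l ->
  C + 2 * P2 <= l'.
Proof. by move=> *; lra. Qed.

(** Here the rate [1 / ln N] of the largest density enters: multiplied by a sum of [qprob] of order
    [ln N], it leaves a multiple of [w]. *)
Lemma sum_sqr_le_sparse (N : nat) (I : finType) (p : I -> R) (w : R) :
  (2 <= N)%N -> (forall i, 0 <= p i <= 1) -> (forall i, p i <= w / ln N%:R) ->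
  1 <= ln (N%:R : R) -> ln N%:R <= w * N%:R -> \sum_i qprob N (p i) <= 2 * ln N%:R ->
  \sum_i p i ^+ 2 <= 6 * w.
Proof.
move=> N2 hp hw l1 lw hQ; have := sum_sqr_le N hp hw.
have n1 : N%:R = N.-1%:R + 1 :> R by rewrite natr1 prednK // ltnW.
have NR2 : 2 <= N%:R :> R by rewrite ler_nat.
have l0 : 0 < ln (N%:R : R) by apply: lt_le_trans l1.
have w0 : 0 <= w by rewrite -(ler_pM2r (_ : 0 < N%:R)) ?mul0r ?(le_trans (ltW l0)) // ltr0n ltnW.
have n0 : 0 < N.-1%:R :> R by move: NR2; rewrite n1; clear; lra.
have r0 : 0 <= w / ln N%:R by rewrite divr_ge0 // ltW.
have rl : w / ln N%:R * ln N%:R = w by rewrite divfK ?gt_eqF.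
move: (\sum_i p i ^+ 2) (\sum_i qprob N (p i)) hQ => P2 Q hQ h.
rewrite -(ler_pM2l n0); apply: (le_trans h).
apply: (@le_trans _ _ ((1 + N.-1%:R * (w / ln N%:R)) * (2 * ln N%:R))).
  by apply: ler_wpM2l => //; rewrite addr_ge0 // mulr_ge0 // ltW.
have -> : (1 + N.-1%:R * (w / ln N%:R)) * (2 * ln N%:R) =
  2 * ln N%:R + 2 * N.-1%:R * (w / ln N%:R * ln N%:R) by ring.
rewrite rl; have : w <= w * N.-1%:R.
  by rewrite ler_peMr //; move: NR2; rewrite n1; clear; lra.
by move: lw; rewrite n1; clear; lra.
Qed.

(** * The given sequence of parameters *)

Section Sequence.
Variables (m : nat -> nat) (p : forall n : nat, 'I_(m n) -> R) (c : nat -> R).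
Arguments p : clear implicits.
Hypothesis hp : forall n : nat, (0 < n)%N -> forall i : 'I_(m n), 0 < p n i < 1.
Hypothesis hmax : forall e : R, 0 < e ->
  \forall n \near \oo, forall i : 'I_(m n), p n i <= e / ln n%:R.
Hypothesis hQ : forall n : nat, (0 < n)%N -> \sum_i qprob n (p n i) = ln n%:R + c n.

Let hp1 n : (0 < n)%N -> forall i : 'I_(m n), 0 <= p n i <= 1.
Proof. by move=> n0 i; have /andP[h1 h2] := hp n0 i; rewrite !ltW. Qed.

Let PM (n : nat) : R :=
  Pr (p n) (fun f : {ffun 'I_(m n) -> {set 'I_n}} => has_perfect_matching (share f)).

Lemma near_le_ln (M : R) : \forall n \near \oo, M <= ln (n%:R : R).
Proof.
near=> n; have h : expR M <= n%:R by near: n; exact: nbhs_infty_ger.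
by rewrite -ler_expR lnK // posrE (lt_le_trans _ h) ?expR_gt0.
Unshelve. all: by end_near. Qed.

Lemma near_ln_le (w : R) : 0 < w -> \forall n \near \oo, ln (n%:R : R) <= w * n%:R.
Proof.
move=> w0; have h := near_sqrt_ln (near_negligible_errors w0).
near=> n.
have n0 : (0 < n)%N by near: n; exact: nbhs_infty_gt.
have NR0 : 0 < (n%:R : R) by rewrite ltr0n.
have B0 : 768 <= Num.sqrt (ln (n%:R : R)) by near: n; apply: filterS h => n [[]].
have : 8 * Num.sqrt (ln (n%:R : R)) ^+ 3 * expR (- Num.sqrt (ln (n%:R : R)) ^+ 2) <= w.
  by near: n; apply: filterS h => n [_ []].
have LB := ln_sqrt_sqr R n0; rewrite LB expRN lnK ?posrE // ler_pdivrMr //.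
apply: le_trans; rewrite -[leLHS]LB; exact: sqr_le_cube.
Unshelve. all: by end_near. Qed.

Lemma near_max_le (e : R) : 0 < e -> \forall n \near \oo, forall i : 'I_(m n), p n i <= e.
Proof.
move=> e0; near=> n => i.
have h : forall i : 'I_(m n), p n i <= e / ln n%:R by near: n; exact: hmax.
apply: (le_trans (h i)).
have l1 : 1 <= ln (n%:R : R) by near: n; exact: near_le_ln.
rewrite ler_pdivrMr ?(lt_le_trans _ l1) //; exact: ler_peMr (ltW e0) l1.
Unshelve. all: by end_near. Qed.

Lemma near_sum_sqr_le (e : R) : 0 < e -> (\forall n \near \oo, c n <= ln n%:R) ->
  \forall n \near \oo, \sum_i p n i ^+ 2 <= e.
Proof.
move=> e0 hc; have w0 : 0 < e / 6 by rewrite divr_gt0.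
near=> n.
have n2 : (2 <= n)%N by near: n; exact: nbhs_infty_ge.
have b : forall i : 'I_(m n), p n i <= e / 6 / ln n%:R by near: n; exact: hmax.
have cn : c n <= ln n%:R by near: n; exact: hc.
have l1 : 1 <= ln (n%:R : R) by near: n; exact: near_le_ln.
have lw : ln (n%:R : R) <= e / 6 * n%:R by near: n; exact: near_ln_le.
have -> : e = 6 * (e / 6) by rewrite mulrC divfK.
apply: (sum_sqr_le_sparse n2 (hp1 (ltnW n2)) b l1 lw).
by rewrite (hQ (ltnW n2)) mulr_natl mulr2n lerD2l.
Unshelve. all: by end_near. Qed.

Lemma near_PM_ge (a a' e : R) : a < a' -> 0 < e -> (\forall n \near \oo, a' <= c n) ->
  \forall n \near \oo, ~~ odd n -> expR (- expR (- a)) - e <= PM n.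
Proof.
move=> aa' e0 hc; near=> n => en.
have n0 : (0 < n)%N by near: n; exact: nbhs_infty_gt.
have b : forall i : 'I_(m n), p n i <= 2^-1.
  by near: n; apply: near_max_le; rewrite invr_gt0.
have h : forall (I : finType) (p : I -> R),
    (forall i, 0 < p i <= 2^-1) -> a' <= \sum_i qprob n (p i) - ln n%:R ->
    expR (- expR (- a)) - e <=
    Pr p (fun f : {ffun I -> {set 'I_n}} => has_perfect_matching (share f)).
  by move: en; near: n; exact: near_perfect_matching.
apply: h => [i|]; first by rewrite b andbT; have /andP[] := hp n0 i.
by rewrite (hQ n0) addrAC subrr add0r; near: n.
Unshelve. all: by end_near. Qed.

Lemma near_PM_le (a e : R) : c @ \oo --> a -> 0 < e ->
  \forall n \near \oo, PM n <= expR (- expR (- a)) + e.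
Proof.
move=> ca e0; have := ca => /cvgrPdist_le hca.
have cl : \forall n \near \oo, c n <= ln n%:R.
  near=> n; apply: (@le_trans _ _ (a + 1)); last by near: n; exact: near_le_ln.
  by apply: distr_le_add1; near: n; exact: hca.
pose d n : R := \big[Num.max/0]_(i < m n) p n i + \sum_i p n i ^+ 2 + `|a - c n|.
have mx0 n : 0 <= \big[Num.max/0]_(i < m n) p n i by apply: bigmax_ge_id.
have P20 n : 0 <= \sum_i p n i ^+ 2 by apply: sumr_ge0 => i _; apply: sqr_ge0.
have d0 : d @ \oo --> (0 : R).
  apply/cvgrPdist_le => x x0; have x3 : 0 < x / 3 by rewrite divr_gt0.
  near=> n; rewrite sub0r normrN ger0_norm ?addr_ge0 //.
  have h1 : \big[Num.max/0]_(i < m n) p n i <= x / 3.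
    have h : forall i : 'I_(m n), p n i <= x / 3 by near: n; exact: near_max_le.
    by apply: bigmax_le => [|i _]; [exact: ltW|exact: h].
  have h2 : \sum_i p n i ^+ 2 <= x / 3 by near: n; exact: near_sum_sqr_le.
  have h3 : `|a - c n| <= x / 3 by near: n; exact: hca.
  have -> : x = x / 3 + x / 3 + x / 3 by rewrite -!mulrDl -mulr2n -mulrSr -[_ *+ 3]mulr_natr mulfK.
  by apply: lerD => //; apply: lerD.
near=> n.
have n0 : (0 < n)%N by near: n; exact: nbhs_infty_gt.
apply: (le_trans (Pr_perfect_matching_le_no_isolated n (hp1 n0))).
have h : forall (I : finType) (q : I -> R), near_threshold n q a (d n) ->
    `|Pr q (@no_isolated 'I_n I) - expR (- expR (- a))| <= e.
  by near: n; exact: Pr_no_isolated_cvg.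
rewrite -lerBlDl; apply: le_trans (ler_norm _) _; apply: h; split=> [i||].
- have /andP[-> _] := hp1 n0 i; apply: (@le_trans _ _ (\big[Num.max/0]_(i < m n) p n i)).
    exact: le_bigmax.
  by rewrite /d -addrA lerDl addr_ge0.
- by rewrite /d addrAC lerDr addr_ge0.
- by rewrite (hQ n0) [ln _ + c n]addrC addrK distrC /d lerDr addr_ge0.
Unshelve. all: by end_near. Qed.

Lemma near_PM_small (e : R) : 0 < e -> (forall A : R, \forall n \near \oo, c n <= A) ->
  \forall n \near \oo, PM n <= e.
Proof.
move=> e0 hc; have e2 : 0 < e / 2 by rewrite divr_gt0.
have cl : \forall n \near \oo, c n <= ln n%:R.
  near=> n; apply: (@le_trans _ _ 0); first by near: n; exact: hc.
  by near: n; exact: near_le_ln.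
(* Each Chebyshev term gets [e / 2]; an eighth of this logarithm is the admissible sum of squares
   for the second one. *)
have l1 : 0 < ln (1 + e / 2) by rewrite ln_gt0 // ltrDl.
have l8 : 0 < ln (1 + e / 2) / 8 by rewrite divr_gt0.
near=> n.
have n0 : (0 < n)%N by near: n; exact: nbhs_infty_gt.
apply: (le_trans (Pr_perfect_matching_le_no_isolated n (hp1 n0))).
have b : forall i : 'I_(m n), p n i <= 4^-1.
  by near: n; apply: near_max_le; rewrite invr_gt0.
have hb i : 0 <= p n i <= 4^-1 by rewrite b andbT; have /andP[] := hp1 n0 i.
have V0 : (0 < #|'I_n|)%N by rewrite card_ord.
apply: (le_trans (Pr_no_isolated_chebyshev V0 hb)); rewrite card_ord (hQ n0).
have -> : ln n%:R + c n - ln n%:R = c n by rewrite addrAC subrr add0r.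
have h1 : \sum_i p n i ^+ 2 <= ln (1 + e / 2) / 8 by near: n; exact: near_sum_sqr_le.
have h2 : c n <= ln (e / 2) - ln (1 + e / 2) by near: n; exact: hc.
have h3 : expR (8 * \sum_i p n i ^+ 2) <= 1 + e / 2.
  have p1 : 0 < 1 + e / 2 by rewrite addr_gt0.
  by rewrite -[leRHS]lnK ?posrE // ler_expR mulrC -ler_pdivlMr.
have h4 : expR (c n + 2 * \sum_i p n i ^+ 2) <= e / 2.
  rewrite -[leRHS]lnK ?posrE // ler_expR.
  exact: chebyshev_exponent_le h1 h2 l1.
have -> : e = e / 2 + (1 + e / 2 - 1) by rewrite addrAC subrr add0r -splitr.
by apply: lerD => //; rewrite lerD2r.
Unshelve. all: by end_near. Qed.

End Sequence.

End Asymptotics.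

Local Open Scope classical_set_scope.
Local Open Scope ring_scope.

Theorem theorem3 (R : realType) (m : nat -> nat) (p : forall n : nat, 'I_(m n) -> R)
    (c : nat -> R)
    (hm : forall n : nat, (0 < n)%N -> (0 < m n)%N)
    (hp : forall n : nat, (0 < n)%N -> forall i : 'I_(m n), 0 < p n i < 1)
    (hmax : (fun n : nat => \big[Num.max/0]_(i < m n) p n i : R^o)
              =o_\oo (fun n : nat => (ln n%:R)^-1 : R^o))
    (hS1 : forall n : nat, (0 < n)%N -> S1 (p n) n = n%:R * (ln n%:R + c n))
    (hc : cvg ((c n)%:E @[n --> \oo])) :
  rig_Pr (p (2 * n)%N)
      (fun W : features (2 * n) (m (2 * n)%N) => has_perfect_matching (rig_adj W))
    @[n --> \oo] --> flim (fun n : nat => c (2 * n)%N).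
Proof.
have hmax' (e : R) : 0 < e -> \forall n \near \oo, forall i : 'I_(m n), p n i <= e / ln n%:R.
  move=> e0; have := hmax => /eqoP/(_ e e0); apply: filterS => n h i.
  have h' : `|\big[Num.max/0]_(j < m n) p n j| <= e * `|(ln n%:R)^-1| := h.
  apply: (le_trans (le_bigmax 0 (p n) i)); apply: (le_trans (ler_norm _)).
  apply: (le_trans h').
  rewrite ger0_norm // invr_ge0.
  (* At [n = 0] the convention [ln 0 = 0] applies. *)
  by case: n {h h' i} => [|n]; [rewrite ln0|rewrite ln_ge0 // ler1n].
have hQ n : (0 < n)%N -> \sum_i qprob n (p n i) = ln n%:R + c n.
  move=> n0; apply: (@mulfI _ (n%:R : R)); first by rewrite pnatr_eq0 -lt0n.
  by rewrite -S1E hS1.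
have even2 n : ~~ odd (2 * n) by rewrite mul2n odd_double.
have c2 : (c (2 * n)%N)%:E @[n --> \oo] --> lim ((c n)%:E @[n --> \oo]).
  by apply: (cvg_comp (fun n => 2 * n)%N _ _ hc) => P; exact: near_double.
apply/cvgrPdist_le => e e0; under eq_near do rewrite rig_Pr_perfect_matching.
rewrite /flim (cvg_lim _ c2) //; move: hc {c2}; case: (lim _) => [r| |] hc.
- have cr : c @ \oo --> r by move/fine_cvgP: hc => [_ ?].
  have exp_cont : (fun a : R => expR (- expR (- a))) @ r --> expR (- expR (- r)).
    apply: continuous_cvg; first exact: continuous_expR.
    apply: cvgN; apply: continuous_cvg; first exact: continuous_expR.
    by apply: cvgN; exact: cvg_id.
  have e2 : 0 < e / 2 by rewrite divr_gt0.
  (* The lower bound needs room below the limit [r]: it is applied with [a = r - d / 2] and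
     [a' = r - d / 4]. *)
  have [d /= d0 hd] : \forall a \near r, `|expR (- expR (- r)) - expR (- expR (- a))| <= e / 2.
    by move/cvgrPdist_le : exp_cont; apply.
  have d2 : 0 < d / 2 by rewrite divr_gt0.
  have ha : expR (- expR (- r)) - e / 2 <= expR (- expR (- (r - d / 2))).
    have := hd (r - d / 2); rewrite /= opprB addrC subrK gtr0_norm // gtr_pMr // invf_lt1 // ltr1n.
    by move/(_ isT); rewrite ler_norml lerBlDl -lerBlDr => /andP[_].
  have d4 : r - d / 2 < r - d / 4 by rewrite ltrD2l ltrN2 ltr_pM2l // ltf_pV2 ?posrE // ltr_nat.
  have low : \forall n \near \oo, r - d / 4 <= c n.
    have d40 : 0 < d / 4 by rewrite divr_gt0.
    have := cr => /cvgrPdist_le/(_ _ d40); apply: filterS => n.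
    by rewrite ler_norml => /andP[_]; rewrite lerBlDl -lerBlDr.
  have H1 := near_double (near_PM_ge hp hmax' hQ d4 e2 low).
  have H2 := near_double (near_PM_le hp hmax' hQ cr e0).
  near=> n; rewrite distrC ler_distl; apply/andP; split; last by near: n; exact: H2.
  rewrite [e]splitr opprD addrA; apply: le_trans (lerD ha (lexx _)) _.
  by have := even2 n; near: n; exact: H1.
- have e2 : 0 < e / 2 by rewrite divr_gt0.
  (* With [expR (- a) = e / 2], the limit at the finite threshold [a] is already within [e / 2] of
     [1]. *)
  pose a : R := - ln (e / 2).
  have ha : 1 - e / 2 <= expR (- expR (- a)).
    by rewrite opprK lnK ?posrE // expR_ge1Dx.
  have a1 : a < a + 1 by rewrite ltrDl.
  have low : \forall n \near \oo, a + 1 <= c n.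
    by move/cvgeyPge : hc => /(_ (a + 1)); apply: filterS => n; rewrite lee_fin.
  have H1 := near_double (near_PM_ge hp hmax' hQ a1 e2 low).
  near=> n; have n0 : (0 < 2 * n)%N by rewrite muln_gt0 /=; near: n; exact: nbhs_infty_gt.
  rewrite ger0_norm ?subr_ge0 ?Pr_le1 //; last first.
    by move=> i; have /andP[? ?] := hp _ n0 i; rewrite !ltW.
  rewrite lerBlDr -lerBlDl [e]splitr opprD addrA; apply: le_trans (lerD ha (lexx _)) _.
  by have := even2 n; near: n; exact: H1.
- have low (A : R) : \forall n \near \oo, c n <= A.
    by move/cvgeNyPle : hc => /(_ A); apply: filterS => n; rewrite lee_fin.
  have H1 := near_double (near_PM_small hp hmax' hQ e0 low).
  near=> n; have n0 : (0 < 2 * n)%N by rewrite muln_gt0 /=; near: n; exact: nbhs_infty_gt.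
  rewrite sub0r normrN ger0_norm; first by near: n; exact: H1.
  by apply: Pr_ge0 => i; have /andP[? ?] := hp _ n0 i; rewrite !ltW.
Unshelve. all: by end_near. Qed.
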